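(* Let $p,q$ be coprime integers with $0<q<p$, and let $n\in\{1,\ldots,p-1\}$. Let $r$ be the difference between the considered framing and the simplest framing of the $n$th unknot in $L(p,q)$. The invariant $I^{(r)}(L_n(p,q))$, for $r=m$ integer or $r=m+\frac12$ half-integer ($m\in\mathbb Z$), is given by $$I^{(m)}(L_n(p,q))=\frac{-1}{\bigl(s_n^{(2m)}\bigr)^2\bigl(t_n^{(2m)}\bigr)^2p^2},\qquad I^{(m+1/2)}(L_n(p,q))=\frac{1}{\bigl(s_n^{(2m+1)}\bigr)^2\bigl(t_n^{(2m)}\bigr)^2p^2},$$ where $$s_n^{(2m)}=(-1)^m(s_n-mp),\qquad s_n^{(2m+1)}=(-1)^{m+1}(s_n-mp-p),\qquad t_n^{(2m)}=t_n+mp=p-s_n+mp.$$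
   Context: A zero denominator in the formulas for $I$ is read as the value infinity, meaning that the complex below is not acyclic ($\det f_3=0$). Triangulated lens space $L_n(p,q)$. Take a bipyramid with upper and lower apex both called $D$, whose equator is a $2p$-gon with vertices in cyclic order $B_1,C_1,B_2,C_2,\ldots,B_p,C_p$ (indices modulo $p$; $B_{i+1}$, $C_{i+1}$ are obtained from $B_i$, $C_i$ by rotation through $2\pi/p$), and with central point $A$. It is divided into $4p$ tetrahedra, the cones with vertex $A$ over the $2p$ upper and $2p$ lower triangles $BCD$ of its surface. $L(p,q)$ is obtained by gluing the upper triangles $B_iC_iD$, $C_iB_{i+1}D$ to the lower triangles $B_{i+q}C_{i+q}D$, $C_{i+q}B_{i+q+1}D$. All $B_i$ become one vertex $B$, all $C_i$ one vertex $C$, the apexes one vertex $D$. The resulting $4p+4$ edges are: $(AB)_i=AB_i$, $(AC)_i=AC_i$, $(BD)_i$ and $(CD)_i$ the upper edges $B_iD$ and $C_iD$ ($i=1,\ldots,p$), $(AD)_1$ and $(AD)_2$ the upper and lower edges $AD$, $(BC)_1$ the common class of all $B_iC_i$ and $(BC)_2$ the common class of all $C_iB_{i+1}$. $L_n(p,q)$ denotes this triangulated lens space with the distinguished chain consisting of the two upper tetrahedra $AB_iC_iD$ with $i=n$ and $i=p$. They share the edges $(AD)_1$ and $(BC)_1$, and the $10$ edges of the chain are $(AB)_i,(CD)_i,(AC)_i,(BD)_i$ for $i=n,p$ and $(AD)_1,(BC)_1$. All tetrahedra are consistently oriented so that the distinguished ones have orientation $BACD$. The chain represents a framed knot (the ''$n$th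 unknot'') going along $n\in\mathbb Z_p=H_1(L(p,q))$; its framing is called the simplest framing. Changing the framing. A half-revolution on the pair of opposite edges $XY,ZW$ of a distinguished tetrahedron $\mathcal T$ is the following operation. Remove $\mathcal T$ and fill its place by three tetrahedra which have the same vertices and all share the four other edges of $\mathcal T$: a tetrahedron $\mathcal T'$ of orientation opposite to $\mathcal T$ with new edges $\widetilde{XY},\widetilde{ZW}$; a tetrahedron of the same orientation as $\mathcal T$ with edges $XY,\widetilde{ZW}$, glued to $\mathcal T'$ along the two faces containing $\widetilde{ZW}$, whose two remaining faces are those of $\mathcal T$ containing $XY$; and a tetrahedron of the same orientation as $\mathcal T$ with edges $\widetilde{XY},ZW$, glued to $\mathcal T'$ along the two faces containing $\widetilde{XY}$, whose two remaining faces are those of $\mathcal T$ containing $ZW$. Vertices of the same name are identified, and $\mathcal T'$ replaces $\mathcal T$ as a distinguished tetrahedron. Positive framing differences: starting from the distinguished tetrahedron $AB_pC_pD$, the first half-revolution is done on the pair $AB,CD$, the second on the pair $AC,BD$ of the new distinguished tetrahedron, the third again on $AB,CD$, and so on alternately; after $h$ half-revolutions the framing differs from the simplest one by $r=h/2$. Half-revolutions in the opposite direction (negative $r$) are done similarly, starting with the pair $AC,BD$. $I^{(r)}(L_n(p,q))$ is the value of $I$ for the triangulation with distinguished chain obtained in this way. Geometry. The vertices $A,B,C,D$ are assigned points of $\mathbb R^3$ not lying in one plane. $l_a$ is the length of edge $a$; oriented volume: $6V_{MNRQ}=\overrightarrow{MN}\cdot\overrightarrow{MQ}\cdot\overrightarrow{MR}$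 (scalar triple product). Every dihedral angle of a tetrahedron, computed from its edge lengths, is taken with the sign of the oriented volume of the (oriented) tetrahedron. The deficit angle at an edge $a$ is $\omega_a=-\sum_i\varphi_i\bmod2\pi$, the sum being over the signed dihedral angles at $a$ of all tetrahedra containing $a$. The $\omega_a$ are functions of independently varied edge lengths, and partial derivatives are taken at the lengths coming from the placement in $\mathbb R^3$. Invariant. Call inner the edges not belonging to the distinguished chain, and let $f_3=(\partial\omega_a/\partial l_b)$ with $a,b$ running over inner edges. As there are no vertices besides $A,B,C,D$, the complex used is $0\to(dl)'\xrightarrow{f_3}(d\omega)'\to0$ (spaces spanned by differentials of lengths of, resp. deficit angles at, inner edges), with torsion $\tau=1/\det f_3$, and $$I=\tau\,\frac{\prod'_{\rm edges}l^2}{\prod'_{\rm tetrahedra}(-6V)}(6V_{ABCD})^4,$$ where the first product is over inner edges and the second over all tetrahedra except the two distinguished ones, with oriented volumes $V$. The numbers $s,t$. Let $G_3=6V_{ABCD}\,\bigl(l_a^{-1}\,\partial\omega_a/\partial l_b\,l_b^{-1}\bigr)$ with $a,b$ running over all edges. For $h\ge0$, after $h$ half-revolutions in the positive direction, let $S_1^{(h)}$ be the block of $G_3$ with rows the edges $AB$ and columns the edges $CD$, and $S_2^{(h)}$ the block with rows the edges $AC$ and columns the edges $BD$ (edges ordered as $1,\ldots,p$, followed by the added edges in order of addition). $s_n^{(h)}$ (resp. $t_n^{(h)}$) is the determinant of the matrix obtained from $S_1^{(h)}$ (resp. $S_2^{(h)}$) by removing the $n$th and the last rows and columns, and $s_n=s_n^{(0)}$,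 $t_n=t_n^{(0)}$. Explicitly, $s_n=nq_n^*-p\nu_n$ and $t_n=p-s_n$, where $q_n^*\in\{1,\ldots,p-1\}$, $qq_n^*\equiv n\bmod p$, and $$\nu_n=\frac1p\sum_{k=0}^{p-1}\frac{1-\zeta^{k(1-n)}}{1-\zeta^k}\,\frac{1-\zeta^{kq(q_n^*-1)}}{1-\zeta^{-kq}},\qquad\zeta=e^{2\pi i/p},$$ the term $k=0$ being understood as its limit $(n-1)(q_n^*-1)$. For $m<0$ the numbers $s_n^{(2m)},s_n^{(2m+1)},t_n^{(2m)}$ are given by the formulas of the claim. *)

(* Defs.v *)
From HB Require Import structures.
From mathcomp Require Import all_boot all_order all_algebra.
From mathcomp Require Import complex.
From mathcomp Require Import all_classical all_reals all_analysis.
Set Implicit Arguments.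
Unset Strict Implicit.
Unset Printing Implicit Defensive.
Import Order.TTheory GRing.Theory Num.Theory.
Import numFieldNormedType.Exports.
Local Open Scope ring_scope.

Inductive vertex := vA | vB | vC | vD.

(* All the triangulations considered have the four vertices A, B, C, D only,
   and every tetrahedron has exactly one vertex of each name; so an edge is a
   pair of vertex names together with a number distinguishing the edges that
   join the same two vertices. *)
Inductive ekind := eAB | eAC | eAD | eBC | eBD | eCD.

Definition ekinds := [:: eAB; eAC; eAD; eBC; eBD; eCD].

Definition ekind_code (k : ekind) : nat :=
  match k with eAB => 0 | eAC => 1 | eAD => 2 | eBC => 3 | eBD => 4 | eCD => 5 end.

Lemma ekind_codeK : cancel ekind_code (nth eAB ekinds).
Proof. by case. Qed.

HB.instance Definition _ := Countable.copy ekind (can_type ekind_codeK).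

Definition edge : Type := (ekind * nat)%type.

Definition ends (k : ekind) : vertex * vertex :=
  match k with
  | eAB => (vA, vB) | eAC => (vA, vC) | eAD => (vA, vD)
  | eBC => (vB, vC) | eBD => (vB, vD) | eCD => (vC, vD)
  end.

Definition opposite (k : ekind) : ekind :=
  match k with
  | eAB => eCD | eAC => eBD | eAD => eBC
  | eBC => eAD | eBD => eAC | eCD => eAB
  end.

(* The values on equal arguments are irrelevant. *)
Definition kind_of (X Y : vertex) : ekind :=
  match X, Y with
  | vA, vB | vB, vA => eAB
  | vA, vC | vC, vA => eAC
  | vA, vD | vD, vA => eAD
  | vB, vC | vC, vB => eBC
  | vB, vD | vD, vB => eBD
  | vC, vD | vD, vC => eCD
  | _, _ => eAB
  end.

(* [positive] is [true] for the orientation ABCD and [false] for BACD; the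
   edge of kind [k] is [(k, lab k)]. *)
Record tetra := Tetra { positive : bool; lab : ekind -> nat }.

(* The edges of kind [k] are [(k, 0)], ..., [(k, nedge k - 1)].  [still] and
   [moving] are the distinguished tetrahedra, [moving] being the one on which
   half-revolutions are performed; [others] lists the remaining tetrahedra. *)
Record triang := Triang {
  nedge : ekind -> nat;
  still : tetra;
  moving : tetra;
  others : seq tetra }.

Definition tetras (X : triang) : seq tetra := [:: still X, moving X & others X].

Definition inner (X : triang) : seq edge :=
  [seq a <- [seq (k, i) | k <- ekinds, i <- iota 0 (nedge X k)]
     | (lab (still X) a.1 != a.2) && (lab (moving X) a.1 != a.2)].

Definition labels (ab ac ad bc bd cd : nat) (k : ekind) : nat :=
  match k with
  | eAB => ab | eAC => ac | eAD => ad | eBC => bc | eBD => bd | eCD => cd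
  end.

(* L(p,q).  Numbering is from 0: the number [i < p] stands for the index
   i + 1 of the edges AB, AC, BD, CD, and the numbers 0, 1 of the edges
   AD, BC stand for 1, 2.  [upper_BC p i], [upper_CB p i] are the cones over the
   upper triangles B_i C_i D, C_i B_{i+1} D; [lower_BC p q i], [lower_CB p q i]
   are the cones over the lower triangles glued to them, that is,
   B_{i+q} C_{i+q} D, C_{i+q} B_{i+q+1} D.  The gluing identifies the lower
   edges B_{i+q} D, C_{i+q} D with the upper edges B_i D, C_i D.
   Tetrahedra sharing a face have opposite orientations. *)
Definition upper_BC (p i : nat) : tetra :=
  Tetra false (labels i i 0 0 i i).
Definition upper_CB (p i : nat) : tetra :=
  Tetra true (labels (i.+1 %% p) i 0 1 (i.+1 %% p) i).
Definition lower_BC (p q i : nat) : tetra :=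
  Tetra true (labels ((i + q) %% p) ((i + q) %% p) 1 0 i i).
Definition lower_CB (p q i : nat) : tetra :=
  Tetra false
    (labels ((i + q).+1 %% p) ((i + q) %% p) 1 1 (i.+1 %% p) i).

Definition lens (p q n : nat) : triang :=
  Triang (labels p p 2 2 p p) (upper_BC p n.-1) (upper_BC p p.-1)
    ([seq upper_BC p i | i <- iota 0 p & (i != n.-1) && (i != p.-1)]
     ++ [seq upper_CB p i | i <- iota 0 p]
     ++ [seq lower_BC p q i | i <- iota 0 p]
     ++ [seq lower_CB p q i | i <- iota 0 p]).

(* The tetrahedron [T] with its edges of the kinds in [ks] replaced by the
   first unused edges of these kinds. *)
Definition relab (X : triang) (T : tetra) (ks : seq ekind) (k : ekind) : nat :=
  if k \in ks then nedge X k else lab T k.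

Definition half_rev (xy : ekind) (X : triang) : triang :=
  let zw := opposite xy in
  let T := moving X in
  Triang (fun k => (nedge X k + (k \in [:: xy; zw]))%N)
    (still X)
    (Tetra (~~ positive T) (relab X T [:: xy; zw]))
    [:: Tetra (positive T) (relab X T [:: zw]),
        Tetra (positive T) (relab X T [:: xy]) & others X].

(* [z] half-revolutions, i.e. framing difference z / 2. *)
Definition framed (p q n : nat) (z : int) : triang :=
  match z with
  | Posz h => iteri h (fun i => half_rev (if odd i then eAC else eAB)) (lens p q n)
  | Negz h => iteri h.+1 (fun i => half_rev (if odd i then eAB else eAC)) (lens p q n)
  end.

Definition dot (R : realType) (u v : 'rV[R]_3) : R := \sum_i u 0 i * v 0 i.

Definition triple (R : realType) (u v w : 'rV[R]_3) : R :=
  \det (\matrix_(i < 3) [:: u; v; w]`_i).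

Definition coplanar (R : realType) (P : vertex -> 'rV[R]_3) : Prop :=
  exists u : 'rV[R]_3, exists c : R, u != 0 /\ forall X, dot u (P X) = c.

(* The scalar triple product of MN, MQ, MK, in this order. *)
Definition vol6 (R : realType) (P : vertex -> 'rV[R]_3) (M N K Q : vertex) : R :=
  triple (P N - P M) (P Q - P M) (P K - P M).

Definition tvol6 (R : realType) (P : vertex -> 'rV[R]_3) (T : tetra) : R :=
  if positive T then vol6 P vA vB vC vD else vol6 P vB vA vC vD.

Definition len (R : realType) (P : vertex -> 'rV[R]_3) (a : edge) : R :=
  let: (X, Y) := ends a.1 in Num.sqrt (dot (P Y - P X) (P Y - P X)).

(* The dihedral angle at XY of the tetrahedron XYZW with edge lengths [L].
   With u = XY, z = XZ, w = XW, scalar products are expressed through the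
   lengths by the law of cosines, and the angle is the one between the
   components of z and w orthogonal to u. *)
Definition dihedral (R : realType) (L : ekind -> R) (k : ekind) : R :=
  let: (X, Y) := ends k in
  let: (Z, W) := ends (opposite k) in
  let uu := L k ^+ 2 in
  let zz := L (kind_of X Z) ^+ 2 in
  let ww := L (kind_of X W) ^+ 2 in
  let uz := (uu + zz - L (kind_of Y Z) ^+ 2) / 2 in
  let uw := (uu + ww - L (kind_of Y W) ^+ 2) / 2 in
  let zw := (zz + ww - L (kind_of Z W) ^+ 2) / 2 in
  acos ((zw - uz * uw / uu)
        / (Num.sqrt (zz - uz ^+ 2 / uu) * Num.sqrt (ww - uw ^+ 2 / uu))).

(* A real representative of the deficit angle, which is defined modulo 2 pi;
   the choice does not affect derivatives.  The signs of the angles are those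
   given by the placement [P] and are locally constant in the lengths [l]. *)
Definition deficit (R : realType) (P : vertex -> 'rV[R]_3) (X : triang)
    (l : edge -> R) (a : edge) : R :=
  - \sum_(T <- tetras X | lab T a.1 == a.2)
      Num.sg (tvol6 P T) * dihedral (fun k => l (k, lab T k)) a.1.

Definition upd (R : realType) (l : edge -> R) (b : edge) (x : R) (a : edge) : R :=
  if a == b then x else l a.

Definition ddeficit (R : realType) (P : vertex -> 'rV[R]_3) (X : triang)
    (a b : edge) : R :=
  derive1 (fun x : R => deficit P X (upd (len P) b x) a) (len P b).

Definition submx_det (R : realType) (F : edge -> edge -> R) (rs cs : seq edge) : R :=
  \det (\matrix_(i < size rs, j < size rs)
          F (nth (eAB, 0%N) rs i) (nth (eAB, 0%N) cs j)).

Definition det_f3 (R : realType) (P : vertex -> 'rV[R]_3) (X : triang) : R :=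
  submx_det (ddeficit P X) (inner X) (inner X).

(* Fractions with values in R plus one point at infinity, [None]. *)
Definition ext_frac (R : realType) (x y : R) : option R :=
  if y == 0 then None else Some (x / y).

(* I = tau * prefactor, where tau = 1 / det f3. *)
Definition prefactor (R : realType) (P : vertex -> 'rV[R]_3) (X : triang) : R :=
  (\prod_(a <- inner X) len P a ^+ 2) / (\prod_(T <- others X) - tvol6 P T)
  * vol6 P vA vB vC vD ^+ 4.

Definition framed_invariant (R : realType) (P : vertex -> 'rV[R]_3) (p q n : nat)
    (z : int) : option R :=
  let X := framed p q n z in
  omap (fun tau : R => tau * prefactor P X) (ext_frac 1 (det_f3 P X)).

Definition G3 (R : realType) (P : vertex -> 'rV[R]_3) (X : triang)
    (a b : edge) : R :=
  vol6 P vA vB vC vD * ((len P a)^-1 * ddeficit P X a b * (len P b)^-1).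

(* The block of G3 with rows of kind [k] and columns of the opposite kind,
   without its nth and last rows and columns (nth is [n.-1] from 0). *)
Definition block_det (R : realType) (P : vertex -> 'rV[R]_3) (X : triang)
    (n : nat) (k : ekind) : R :=
  let I := [seq i <- iota 0 (nedge X k) | (i != n.-1) && (i != (nedge X k).-1)] in
  submx_det (G3 P X) [seq (k, i) | i <- I] [seq (opposite k, i) | i <- I].

Definition s_det (R : realType) (P : vertex -> 'rV[R]_3) (p q n h : nat) : R :=
  block_det P (framed p q n h) n eAB.

Definition t_det (R : realType) (P : vertex -> 'rV[R]_3) (p q n h : nat) : R :=
  block_det P (framed p q n h) n eAC.

Definition zeta (R : realType) (p : nat) : R[i] :=
  Complex (cos (2 * pi / p%:R)) (sin (2 * pi / p%:R)).

(* [qs] stands for the solution q_n^* of q x = n modulo p; the first summand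
   is the term k = 0. *)
Definition nu_val (R : realType) (p q n qs : nat) : R[i] :=
  p%:R^-1 *
  ((n%:R - 1) * (qs%:R - 1) +
   \sum_(1 <= k < p)
     (1 - zeta R p ^ (k%:Z * (1 - n%:Z))) / (1 - zeta R p ^ k%:Z) *
     ((1 - zeta R p ^ (k%:Z * q%:Z * (qs%:Z - 1)))
      / (1 - zeta R p ^ (- (k%:Z * q%:Z))))).

(* Main.v *)
Require Import Defs.
From mathcomp Require Import all_boot all_order all_algebra.
From mathcomp Require Import perm ring zify lra.
From mathcomp Require Import complex.
From mathcomp Require Import all_classical all_reals all_analysis.
Set Implicit Arguments.
Unset Strict Implicit.
Unset Printing Implicit Defensive.
Import Order.TTheory GRing.Theory Num.Theory.
Local Open Scope ring_scope.

(** Let W(a,b) be the sum of the orientation signs of the tetrahedra that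
    contain both edges a and b.  The derivative of the deficit angle at a in the
    length of b is, up to the sign of V_ABCD, minus W(a,b) times the derivative
    of a dihedral angle (ddeficitE).  If a and b can lie in a common face,
    W(a,b) = 0, because a face is shared by two tetrahedra of opposite
    orientations (incidence_face).  If they are of opposite kinds, the angle
    derivative is l_a l_b / |6V| (dihedral_derivative).  Therefore G_3 is the
    integer matrix -W, supported on the pairs AB-CD, AC-BD and AD-BC.  Up to
    lengths and volumes, which the prefactor of I removes, det f_3 is a sign
    times s^2 t^2 p^2, with s and t the determinants of the inner parts of the
    blocks AB-CD and AC-BD (minor_inner, invariant_state).

    A half-revolution on a distinguished tetrahedron of orientation e changes
    only one block of -W and its transpose, by e times the tensor square of
    (old label) - (new label) (incidence_half_rev).  If d is the determinant
    without both distinguished labels and m the one without the fixed label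
    only, the new values are m + e d and e m (minor_half_rev).  The orientations
    and the kinds both alternate, so that each block always meets the same e,
    and d is affine in the number of half-revolutions up to sign
    (revolved_invariants).

    For L(p,q) itself, with S the cyclic shift of Z/p, the two blocks are
    (1 - S)(1 - S^q) and (1 - S^-1)(1 - S^q).  Their principal minors of
    corank one are p (minor_mul), so that m starts at p.  By Cramer's rule
    s = X n - X 0, where X is any solution of
    (1 - S)(1 - S^q) X = p (delta_n - delta_0).  Inverting the two factors one
    after the other gives such an X, with
    X n = n q* - p #{0 < l < q* : q l mod p < n} (minor_solution, lens_s_nu),
    and the count is nu_n by orthogonality of characters (root_sum_count).
    Since 1 - S^-1 = - S^-1 (1 - S), the same X gives t, and s + t = p
    (minor_solution_opp). *)

(** * Minors indexed by lists of labels *)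

(** Rows and columns are addressed by lists of labels, because the matrices at
    hand have rows labelled by edges or by residues and lose some of them.  The
    default labels are never reached when the two lists have the same
    length. *)
Definition minor (R : comNzRingType) (T U : Type) (x0 : T) (y0 : U)
    (F : T -> U -> R) (rs : seq T) (cs : seq U) : R :=
  \det (\matrix_(i < size rs, j < size rs) F (nth x0 rs i) (nth y0 cs j)).

Section Minors.
Variable R : comNzRingType.

Lemma eq_minor (T U : eqType) (x0 : T) (y0 : U) (F G : T -> U -> R) rs cs :
  size rs = size cs ->
  {in rs & cs, forall i j, F i j = G i j} ->
  minor x0 y0 F rs cs = minor x0 y0 G rs cs.
Proof.
move=> sz FG; congr (\det _); apply/matrixP=> i j; rewrite !mxE.
by apply: FG; rewrite mem_nth // -sz.
Qed.

Lemma minor_map (T U T' U' : Type) (x0 : T) (y0 : U) (x1 : T') (y1 : U')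
    (f : T' -> T) (g : U' -> U) (F : T -> U -> R) rs cs :
  size rs = size cs ->
  minor x0 y0 F (map f rs) (map g cs)
  = minor x1 y1 (fun i j => F (f i) (g j)) rs cs.
Proof.
move=> sz; rewrite /minor size_map; congr (\det _); apply/matrixP=> i j.
by rewrite !mxE (nth_map x1) // (nth_map y1) // -sz.
Qed.

Lemma minor_perm (T : eqType) (x0 : T) (F : T -> T -> R) (rs cs : seq T) :
  perm_eq rs cs -> minor x0 x0 F rs rs = minor x0 x0 F cs cs.
Proof.
move=> rscs; have sz := perm_size rscs.
have [s rsE] := elimT (@tuple_permP T _ rs (in_tuple cs)) rscs.
have nthE (i : 'I_(size cs)) : nth x0 rs i = nth x0 cs (s i).
  by rewrite rsE -tnth_nth tnth_mktuple (tnth_nth x0).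
rewrite /minor; move: rs sz nthE {rscs rsE} => rs sz nthE.
case: _ / (esym sz) .
rewrite (_ : (\matrix_(i, j) _) = row_perm s (col_perm s
   (\matrix_(i < size cs, j < size cs) F (nth x0 cs i) (nth x0 cs j)))).
  rewrite row_permE col_permE !det_mulmx !det_perm.
  by rewrite odd_permV mulrA mulrAC -signr_addb addbb expr0 mul1r.
by apply/matrixP=> i j; rewrite !mxE !nthE.
Qed.

Lemma minor_scale (T : Type) (x0 : T) (a b : T -> R) (F : T -> T -> R) s :
  minor x0 x0 (fun i j => a i * F i j * b j) s s
  = (\prod_(i <- s) a i) * minor x0 x0 F s s * \prod_(i <- s) b i.
Proof.
rewrite /minor !(big_nth x0) !big_mkord.
have prodE (c : T -> R) : \prod_(i < size s) c (nth x0 s i)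
    = \det (diag_mx (\row_(i < size s) c (nth x0 s i))).
  by rewrite det_diag; apply: eq_bigr => i _; rewrite mxE.
rewrite !prodE -!det_mulmx; congr (\det _); apply/matrixP => i j.
rewrite mul_mx_diag mxE mul_diag_mx !mxE //.
Qed.

Lemma minor_lower (T : Type) (x0 : T) (F : T -> T -> R) s :
  (forall i j, (i < j < size s)%N -> F (nth x0 s i) (nth x0 s j) = 0) ->
  minor x0 x0 F s s = \prod_(i <- s) F i i.
Proof.
move=> F0; rewrite /minor det_trig.
  by rewrite (big_nth x0) big_mkord; apply: eq_bigr => i _; rewrite mxE.
by apply/is_trig_mxP => i j ij; rewrite mxE F0 // ij ltn_ord.
Qed.

Lemma minor_cat (T : eqType) (x0 : T) (F : T -> T -> R) s t :
  {in s & t, forall i j, F i j = 0} ->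
  minor x0 x0 F (s ++ t) (s ++ t) = minor x0 x0 F s s * minor x0 x0 F t t.
Proof.
move=> F0; rewrite /minor size_cat.
rewrite -(@det_lblock _ _ _ _ (\matrix_(i < size t, j < size s)
     F (nth x0 t i) (nth x0 s j))).
congr (\det _); apply/matrixP => i j; rewrite !mxE !nth_cat.
case: splitP => k ->; rewrite mxE; case: splitP => l ->; rewrite mxE /= ?addKn;
  rewrite ?ltnNge ?leq_addr -?ltnNge ?ltn_ord //=.
by rewrite F0 ?mem_nth.
Qed.

(** The sign is that of the exchange of two blocks of n columns. *)
Lemma det_antidiag_block n (B C : 'M[R]_n) :
  \det (block_mx 0 B C 0) = (-1) ^+ n * \det B * \det C.
Proof.
have -> : block_mx 0 B C 0 = block_mx B 0 0 C *m block_mx 0 1%:M 1%:M 0.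
  by rewrite mulmx_block !mul0mx !mulmx0 !mulmx1 !addr0 !add0r.
rewrite det_mulmx det_lblock mulrC mulrA; congr (_ * _ * _).
have := congr1 determinant (mulmx_block (1%:M : 'M[R]_n) (- 1%:M) 0 1%:M
  0 1%:M 1%:M 1%:M).
have -> : block_mx 0 1%:M 1%:M 1%:M
    = block_mx 0 1%:M 1%:M 0 *m block_mx 1%:M 1%:M 0 (1%:M : 'M[R]_n).
  by rewrite mulmx_block !mul0mx !mulmx0 !mulmx1 !addr0 !add0r.
rewrite !det_mulmx !det_ublock !det1 !mulr1 !mul1r => ->.
rewrite !mul1mx !mul0mx !mulmx1 addrN !add0r det_lblock det1 mulr1.
by rewrite -scaleN1r detZ det1 mulr1.
Qed.

Lemma minor_anticat (T : eqType) (x0 : T) (F : T -> T -> R) s t :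
  size s = size t ->
  {in s &, forall i j, F i j = 0} -> {in t &, forall i j, F i j = 0} ->
  minor x0 x0 F (s ++ t) (s ++ t)
  = (-1) ^+ size s * minor x0 x0 F s t * minor x0 x0 F t s.
Proof.
move=> sz Fs Ft; rewrite /minor size_cat -sz -det_antidiag_block.
congr (\det _); apply/matrixP => i j; rewrite !mxE !nth_cat.
case: splitP => k ->; rewrite mxE; case: splitP => l ->; rewrite mxE -?sz ?addKn.
all: rewrite ?[(_ + _ < _)%N]ltnNge ?leq_addr ?ltn_ord //=.
  by rewrite Fs ?mem_nth.
by rewrite Ft ?mem_nth -?sz.
Qed.

(** Cramer's rule for one unknown, written without a division: multiply
    A x = c e_a by the adjugate of A and read the entry a. *)
Lemma minor_cons (T : eqType) (x0 : T) (F : T -> T -> R) a s (x : T -> R) c :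
  \sum_(j <- a :: s) F a j * x j = c ->
  {in s, forall i, \sum_(j <- a :: s) F i j * x j = 0} ->
  minor x0 x0 F (a :: s) (a :: s) * x a = minor x0 x0 F s s * c.
Proof.
move=> Fa Fs; rewrite /minor /=; set A := \matrix_(i, j) F _ _.
set B := \matrix_(i, j) _.
pose X := \col_(i < (size s).+1) x (nth x0 (a :: s) i).
have AX i : (A *m X) i 0 = c *+ (i == 0).
  rewrite mxE; transitivity (\sum_(j <- a :: s) F (nth x0 (a :: s) i) j * x j).
    by rewrite [RHS](big_nth x0) big_mkord; apply: eq_bigr => j _; rewrite !mxE.
  case: (unliftP 0 i) => [k|] -> /=; last by rewrite Fa.
  by apply: Fs; apply: mem_nth; exact: (ltn_ord k).
have := congr1 (fun Y : 'cV[R]_(size s).+1 => Y 0 0) (mulmxA (\adj A) A X).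
rewrite mul_adj_mx mul_scalar_mx !mxE /= => <-.
under eq_bigr => j _ do rewrite AX.
rewrite (bigD1 0) //= ?eqxx big1 ?addr0 => [|j /negPf ->]; last by rewrite mulr0.
rewrite mxE /cofactor /= expr0 mul1r; congr (\det _ * _).
by apply/matrixP => i j; rewrite !mxE /=.
Qed.

(** Expansion of the determinant along the row that is changed. *)
Lemma minor_corner (T : eqType) (x0 : T) (F : T -> T -> R) a s c :
  a \notin s ->
  minor x0 x0 (fun i j => F i j + c *+ ((i == a) && (j == a))) (a :: s) (a :: s)
  = minor x0 x0 F (a :: s) (a :: s) + c * minor x0 x0 F s s.
Proof.
move=> as'; rewrite /minor -[X in _ = _ + c * X]mul1r -(det1 R 1).
have nthsa (k : 'I_(size s)) : (nth x0 s k == a) = false.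
  by apply: contraNF as' => /eqP <-; rewrite mem_nth.
rewrite -(@det_lblock _ _ _ _ (\matrix_(i < size s, j < 1)
  (F (nth x0 s i) a))).
rewrite -[X in X + _]mul1r.
apply: (@determinant_multilinear _ _ _ _ _ 0).
- apply/rowP => j; rewrite !mxE /= eqxx mul1r; congr (_ + _).
  rewrite (_ : fintype.split (0 : 'I_(1 + _)) = inl 0); last first.
    by case: splitP => k //= _; rewrite ord1.
  rewrite mxE; case: splitP => l ->; rewrite mxE ?ord1 /= ?eqxx ?mulr1 //.
  by rewrite nthsa mulr0.
- by apply/matrixP => i j; rewrite !mxE /= nthsa /= addr0.
apply/matrixP => i j; rewrite !mxE.
rewrite (_ : fintype.split (lift (0 : 'I_(1 + _)) i) = inr i); last first.
  by case: splitP => k /= e; [case: k e => [[]] | congr inr; apply: val_inj; case: e].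
rewrite mxE; case: splitP => l ->; rewrite mxE ?ord1 /= nthsa /= addr0 //.
Qed.

(** The two block triangular factorizations of one bordered matrix. *)
Lemma det_rank1_perturbation n (v : 'cV[R]_n) (u : 'rV[R]_n) :
  \det (1%:M + v *m u) = 1 + (u *m v) 0 0.
Proof.
pose A := block_mx (1%:M : 'M[R]_1) (- u) v 1%:M.
have -> : \det (1%:M + v *m u) = \det A.
  have -> : A = block_mx 1%:M 0 v 1%:M *m block_mx 1%:M (- u) 0 (1%:M + v *m u).
    rewrite mulmx_block !mul0mx !mulmx0 !mulmx1 !mul1mx !addr0 !mulmxN.
    by rewrite addrCA addNr addr0.
  by rewrite det_mulmx det_lblock det_ublock !det1 !mul1r.
have -> : A = block_mx 1%:M (- u) 0 1%:M *m block_mx (1%:M + u *m v) 0 v 1%:M.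
  rewrite mulmx_block !mul0mx !mulmx0 !mulmx1 !mul1mx !add0r !mulNmx.
  by rewrite addrK.
by rewrite det_mulmx det_lblock det_ublock !det1 !mul1r mulr1 det_mx11 !mxE.
Qed.

(** A half-revolution changes a block in this way, a being the old and b the
    new label.  Adding row b to row a cancels the change in row a and leaves a
    block triangular matrix with corner c; the product of block matrices in the
    proof performs this row operation. *)
Lemma minor_chain (T : eqType) (x0 : T) (F : T -> T -> R) a b s c :
  a != b -> a \notin s -> b \notin s ->
  (forall i, F i b = 0) -> (forall j, F b j = 0) ->
  minor x0 x0 (fun i j => F i j
     + c * ((i == a)%:R - (i == b)%:R) * ((j == a)%:R - (j == b)%:R))
    (b :: a :: s) (b :: a :: s)
  = c * minor x0 x0 F (a :: s) (a :: s).
Proof.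
move=> ab as' bs Fb Fb'; rewrite /minor /=; set G := \matrix_(i, j) F _ _.
pose e : 'rV[R]_(size s).+1 := delta_mx 0 0.
transitivity (\det (block_mx 1%:M 0 (- e^T) 1%:M : 'M[R]_(1 + (size s).+1))
              * \det (block_mx (c%:M : 'M[R]_1) (- (c *: e)) 0 G)); last first.
  by rewrite det_lblock det_ublock !det1 !mul1r det_scalar1.
rewrite -det_mulmx; congr (\det _).
rewrite mulmx_block !mul0mx !mulmx0 !mul1mx !addr0.
apply/matrixP => i j; rewrite !mxE.
have nthsa (k : 'I_(size s)) : (nth x0 s k == a) = false.
  by apply: contraNF as' => /eqP <-; rewrite mem_nth.
have nthsb (k : 'I_(size s)) : (nth x0 s k == b) = false.
  by apply: contraNF bs => /eqP <-; rewrite mem_nth.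
have ba : (b == a) = false by rewrite eq_sym (negPf ab).
case: splitP => k ->; rewrite mxE; case: splitP => l ->; rewrite !mxE ?ord1 /=.
all: rewrite ?big_ord1 ?mxE ?eqxx ?Fb ?Fb' ?ba ?subr0 ?sub0r ?mulrNN ?mulr1 ?add0r //.
- by rewrite !mulr1n -mulrA mulrNN !mulr1.
- case: (unliftP 0 l) => [m|] -> /=; rewrite /= ?nthsa ?nthsb ?eqxx ?(negPf ab) ?mulr1n
    ?subr0 ?mulrN1 ?mulr0 ?mulr1 ?oppr0 //.
- case: (unliftP 0 k) => [m|] -> /=; rewrite /= ?nthsa ?nthsb ?eqxx ?(negPf ab) ?mulr1n
    ?subr0 ?mulr0 ?mul0r ?oppr0 
    ?mul0r ?mulr1 ?mul1r ?mulrN1 ?mulN1r //.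
rewrite addrC; congr (_ + _).
case: (unliftP 0 k) => [m|] -> /=; rewrite /= ?nthsa ?nthsb ?subr0 ?mulr0 ?mul0r //.
case: (unliftP 0 l) => [m|] -> /=; rewrite /= ?nthsa ?nthsb ?subr0 ?mulr0 ?mul0r //.
rewrite ?eqxx (negPf ab) ?mulr1n !subr0; ring.
Qed.

(** Cauchy--Binet for corank one factors.  The row of V and the column of U
    at a are minus the sums of the others, so that the minor of U V without a is
    U' (1 + J) V' with J the all-ones matrix, and 1 + J has determinant
    1 + size s. *)
Lemma minor_mul (T : Type) (x0 : T) (U V : T -> T -> R) a s :
  (forall i, \sum_(j <- a :: s) U i j = 0) ->
  (forall j, \sum_(i <- a :: s) V i j = 0) ->
  minor x0 x0 (fun i j => \sum_(k <- a :: s) U i k * V k j) s s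
  = (size s).+1%:R * minor x0 x0 U s s * minor x0 x0 V s s.
Proof.
move=> U0 V0; pose M := 1%:M
  + (const_mx 1 : 'cV[R]_(size s)) *m (const_mx 1 : 'rV[R]_(size s)).
have -> : (size s).+1%:R = \det M.
  rewrite det_rank1_perturbation !mxE.
  under eq_bigr => i _ do rewrite !mxE mulr1.
  by rewrite sumr_const card_ord -natr1 addrC.
rewrite [\det M * _]mulrC /minor -!det_mulmx; congr (\det _).
have UaE i : U i a = - \sum_(j <- s) U i j.
  by have /eqP := U0 i; rewrite big_cons addr_eq0 => /eqP.
have VaE j : V a j = - \sum_(i <- s) V i j.
  by have /eqP := V0 j; rewrite big_cons addr_eq0 => /eqP.
rewrite mulmxDr mulmx1 mulmxDl mulmxA -mulmxA addrC.
apply/matrixP => i j; rewrite !mxE big_cons UaE VaE mulrNN; congr (_ + _).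
  rewrite big_ord1 !mxE; congr (_ * _); rewrite (big_nth x0) big_mkord;
  by apply: eq_bigr => k _; rewrite !mxE ?mulr1 ?mul1r.
by rewrite (big_nth x0) big_mkord; apply: eq_bigr => k _; rewrite !mxE.
Qed.

End Minors.

(** * Circulant matrices and a linear system over Z/p *)

Section Circulant.
Variables (R : numFieldType) (p : nat).
Hypothesis p_gt1 : (1 < p)%N.
Implicit Types (a b c u v x z : 'Z_p) (f : 'Z_p -> R).

Let p_gt0 : (0 < p)%N := ltnW p_gt1.

Lemma val_ZpN k : (k < p)%N -> (k%:R : 'Z_p) = k :> nat.
Proof. by move=> kp; rewrite val_Zp_nat // modn_small. Qed.

Lemma ltn_Zp x : (x < p)%N.
Proof. by rewrite -[X in (_ < X)%N](Zp_cast p_gt1). Qed.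

Lemma eq_ZpN k l : (k < p)%N -> (l < p)%N -> (k%:R == l%:R :> 'Z_p) = (k == l).
Proof. by move=> kp lp; rewrite -val_eqE /= !val_ZpN. Qed.

Lemma val_Zp_sub1 z :
  (z - 1 : 'Z_p) = (if (z : nat) == 0 then p.-1 else (z : nat).-1)%N :> nat.
Proof.
have zp := ltn_Zp z; case: eqP => [z0|/eqP z0].
  have -> : z - 1 = (p.-1)%:R.
    have -> : z = 0 by apply: val_inj.
    apply/(addIr 1); rewrite subrK -[in LHS](pchar_Zp p_gt1) natr1 prednK //.
  by rewrite val_ZpN // prednK.
have -> : z - 1 = (z : nat).-1%:R.
  by apply/(addIr 1); rewrite subrK natr1 prednK ?lt0n // natr_Zp.
by rewrite val_ZpN // (leq_ltn_trans (leq_pred _)).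
Qed.

Lemma sum_Zp f : \sum_x f x = \sum_(0 <= l < p) f l%:R.
Proof.
rewrite -[X in index_iota 0 X](Zp_cast p_gt1) big_mkord; apply: eq_bigr => i _.
by rewrite natr_Zp.
Qed.

(** With S the cyclic shift by one, this is the matrix of 1 - S^u. *)
Definition shift_diff u a b : R := (a == b)%:R - (a == b + u)%:R.

Lemma shift_diff_act u a f :
  \sum_b shift_diff u a b * f b = f a - f (a - u).
Proof.
under eq_bigr => b _ do rewrite mulrBl.
rewrite sumrB; congr (_ - _).
  rewrite (bigD1 a) //= eqxx mul1r big1 ?addr0 // => b.
  by rewrite eq_sym => /negPf ->; rewrite mul0r.
rewrite (bigD1 (a - u)) //= subrK eqxx mul1r big1 ?addr0 // => b.
by rewrite -[a == _]subr_eq [_ == b]eq_sym => /negPf ->; rewrite mul0r.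
Qed.

Lemma shift_diff_row u a : \sum_b shift_diff u a b = 0.
Proof.
rewrite -[RHS](subrr 1) -(shift_diff_act u a (fun=> 1)).
by apply: eq_bigr => b _; rewrite mulr1.
Qed.

Lemma shift_diff_col u b : \sum_a shift_diff u a b = 0.
Proof.
rewrite sumrB (bigD1 b) //= eqxx big1 ?addr0 => [|a /negPf -> //].
by rewrite (bigD1 (b + u)) //= eqxx big1 ?addr0 ?subrr // => a /negPf ->.
Qed.

Definition outside (cs : seq 'Z_p) := [seq x <- enum 'Z_p | x \notin cs].

Lemma outside_uniq cs : uniq (outside cs).
Proof. exact/filter_uniq/enum_uniq. Qed.

Lemma mem_outside cs x : (x \in outside cs) = (x \notin cs).
Proof. by rewrite mem_filter mem_enum andbT. Qed.

Lemma perm_outside c cs : c \notin cs -> perm_eq (outside cs) (c :: outside (c :: cs)).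
Proof.
move=> ccs; apply: uniq_perm; rewrite /= ?outside_uniq //=.
  by rewrite mem_outside inE eqxx.
move=> x; rewrite inE !mem_outside inE.
by case: (eqVneq x c) => [->|_] /=; rewrite ?ccs ?andbT.
Qed.

Lemma sum_outside0 f : \sum_(x <- outside [::]) f x = \sum_x f x.
Proof. by rewrite big_filter big_enum_cond; apply: eq_bigl => x. Qed.

Lemma sum_outside1 f c : \sum_(x <- c :: outside [:: c]) f x = \sum_x f x.
Proof. by rewrite -sum_outside0 (perm_big _ (@perm_outside c [::] isT)). Qed.

(** Listing the labels in the order c + u, c + 2 u, ... makes the matrix lower
    triangular with unit diagonal; c is missing, and it is the only label where
    the cycle would close. *)
Lemma minor_shift_diff u c : u \is a GRing.unit ->
  minor 0 0 (shift_diff u) (outside [:: c]) (outside [:: c]) = 1.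
Proof.
move=> uu; pose h k : 'Z_p := c + k%:R * u.
have hE k l : (k < p)%N -> (l < p)%N -> (h k == h l) = (k == l).
  by move=> kp lp; rewrite (inj_eq (addrI c)) (inj_eq (mulIr uu)) eq_ZpN.
have hp : perm_eq (outside [:: c]) (map h (iota 1 p.-1)).
  apply: uniq_perm; rewrite ?outside_uniq //.
    rewrite map_inj_in_uniq ?iota_uniq // => k l.
    rewrite !mem_iota add1n prednK // => /andP[_ kp] /andP[_ lp] /eqP.
    by rewrite hE // => /eqP.
  move=> x; rewrite mem_outside inE; apply/idP/mapP.
    move=> xc; exists ((x - c) / u : nat).
      rewrite mem_iota add1n prednK // ltn_Zp andbT lt0n.
      apply: contra xc => /eqP e0; rewrite -subr_eq0 -[x - c](divrK uu).
      by rewrite (_ : (x - c) / u = 0) ?mul0r //; apply: val_inj.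
    by rewrite /h natr_Zp divrK // addrC subrK.
  move=> [k]; rewrite mem_iota add1n prednK // => /andP[k0 kp] ->.
  rewrite -[c in _ == c]addr0 -(mul0r u) -/(h 0%N) (hE k 0%N) //.
    by rewrite -lt0n.
rewrite (minor_perm 0 _ hp) (minor_map 0 0 0%N 0%N) //.
have hS k l : (0 < k <= l)%N -> (l < p)%N -> (h k == h l + u) = false.
  move=> /andP[k0 kl] lp; have -> : h l + u = h l.+1.
    by rewrite /h -addrA -natr1 mulrDl mul1r.
  have [lp'|lp'] := ltnP l.+1 p.
    by rewrite hE ?(leq_ltn_trans kl) // ltn_eqF.
  have -> : h l.+1 = h 0%N.
    rewrite /h (_ : l.+1 = p) ?pchar_Zp //; by apply/eqP; rewrite eqn_leq lp lp'.
  by rewrite hE ?(leq_ltn_trans kl) ?(ltnW p_gt1) // gtn_eqF.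
rewrite minor_lower => [|i j].
  rewrite big_seq big1 // => k; rewrite mem_iota add1n prednK //.
  move=> /andP[k0 kp]; rewrite /shift_diff eqxx hS ?subr0 //.
  by rewrite k0 leqnn.
rewrite size_iota => /andP[ij jp]; rewrite !nth_iota ?(ltn_trans ij) // !add1n.
have jp' : (j.+1 < p)%N by rewrite -(prednK (ltnW p_gt1)).
rewrite /shift_diff hS //=; last exact: ltnW.
have ip : (i.+1 < p)%N by exact: ltn_trans jp'.
by rewrite (hE _ _ ip jp') eqSS (ltn_eqF ij) subr0.
Qed.

Definition shift_diff_mul u v a b : R :=
  \sum_x shift_diff u a x * shift_diff v x b.

Lemma size_outside1 c : (size (outside [:: c])).+1 = p.
Proof.
have := perm_size (@perm_outside c [::] isT); rewrite /= => <-.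
by rewrite size_filter count_predT -cardE card_ord Zp_cast.
Qed.

Lemma minor_shift_diff_mul u v c : u \is a GRing.unit -> v \is a GRing.unit ->
  minor 0 0 (shift_diff_mul u v) (outside [:: c]) (outside [:: c]) = p%:R.
Proof.
move=> uu vu.
have := @minor_mul _ _ 0 (shift_diff u) (shift_diff v) c (outside [:: c]).
rewrite !minor_shift_diff // size_outside1 !mulr1 => <-.
- apply: eq_minor => // a b _ _.
  by rewrite sum_outside1.
- by move=> a; rewrite sum_outside1 shift_diff_row.
by move=> b; rewrite sum_outside1 shift_diff_col.
Qed.

Lemma shift_diff_mul_act u v a f :
  \sum_b shift_diff_mul u v a b * f b
  = (f a - f (a - v)) - (f (a - u) - f (a - u - v)).
Proof.
rewrite -(shift_diff_act u a (fun x => f x - f (x - v))).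
under eq_bigr => b _ do rewrite mulr_suml.
rewrite exchange_big; apply: eq_bigr => x _.
by rewrite -shift_diff_act mulr_sumr; apply: eq_bigr => b _; rewrite mulrA.
Qed.

Lemma shift_diff_mul_row u v a : \sum_b shift_diff_mul u v a b = 0.
Proof.
rewrite -[RHS](subrr 0) -[X in _ = X - _](subrr 1) -[X in _ = _ - X](subrr 1).
rewrite -(shift_diff_mul_act u v a (fun=> 1)); by apply: eq_bigr => b _; rewrite mulr1.
Qed.

(** By Cramer's rule in the principal minor without 0, whose determinant is p,
    once the solution has been normalized to vanish at 0. *)
Lemma minor_shift_diff_mul_solve u v n f :
    u \is a GRing.unit -> v \is a GRing.unit -> n != 0 ->
    (forall a, (f a - f (a - v)) - (f (a - u) - f (a - u - v))
       = p%:R * ((a == n)%:R - (a == 0)%:R)) ->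
  minor 0 0 (shift_diff_mul u v) (outside [:: n; 0]) (outside [:: n; 0]) = f n - f 0.
Proof.
move=> uu vu n0 fE.
have p0 : p%:R != 0 :> R by rewrite pnatr_eq0 -lt0n ltnW.
have perm0 : perm_eq (outside [:: 0]) (n :: outside [:: n; 0]).
  by apply: perm_outside; rewrite inE.
have sumE a : \sum_(b <- n :: outside [:: n; 0]) shift_diff_mul u v a b * (f b - f 0)
    = p%:R * ((a == n)%:R - (a == 0)%:R).
  rewrite -(perm_big _ perm0) -fE -shift_diff_mul_act -[RHS](sum_outside1 _ 0) big_cons.
  under eq_bigr => b _ do rewrite mulrBr.
  rewrite sumrB addrC; congr (_ + _); rewrite -mulr_suml -mulNr; congr (_ * _).
  have /eqP := shift_diff_mul_row u v a; rewrite -(sum_outside1 _ 0) big_cons addr_eq0.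
  by move=> /eqP ->.
apply: (mulfI p0); rewrite [LHS]mulrC.
rewrite -(@minor_cons _ _ 0 (shift_diff_mul u v) n (outside [:: n; 0])
  (fun b => f b - f 0)).
- by rewrite -(minor_perm 0 _ perm0) minor_shift_diff_mul.
- by rewrite sumE eqxx (negPf n0) subr0 mulr1.
move=> a; rewrite mem_outside !inE negb_or => /andP[/negPf an /negPf a0].
by rewrite sumE an a0 subrr mulr0.
Qed.
Definition antidiff f z : R := \sum_(1 <= l < (z : nat).+1) f l%:R.

(** The step from p - 1 to 0 is the only one that is not immediate from the
    definition; there the zero total of f is what closes the cycle. *)
Lemma antidiffP f z :
  \sum_x f x = 0 -> antidiff f z - antidiff f (z - 1) = f z.
Proof.
rewrite sum_Zp => f0; rewrite /antidiff val_Zp_sub1; case: eqP => z0.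
  rewrite z0 big_geq // sub0r prednK //.
  move/eqP: f0; rewrite big_ltn // addrC addr_eq0 => /eqP ->; rewrite opprK.
  by congr f; apply: val_inj.
case E: (z : nat) z0 => [//|k] _ /=.
by rewrite big_nat_recr //= addrAC subrr add0r -E natr_Zp.
Qed.

Section Solution.
Variables (n q : 'Z_p).
Hypotheses (n_neq0 : n != 0) (q_unit : q \is a GRing.unit).

(** The solution y of (1 - S) y = p (delta_n - delta_0) with zero total; zero
    total is what makes it an image of 1 - S^q. *)
Definition step_fun x : R := n%:R - p%:R * (x < n)%:R.

Lemma val_n_gt0 : (0 < n)%N.
Proof. by rewrite lt0n; apply: contra n_neq0 => /eqP e; apply/eqP/val_inj. Qed.

Lemma step_fun_diff x :
  step_fun x - step_fun (x - 1) = p%:R * ((x == n)%:R - (x == 0)%:R).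
Proof.
rewrite /step_fun val_Zp_sub1 -(val_eqE x 0) -(val_eqE x n) /=.
have n0 := val_n_gt0; have np := ltn_Zp n.
case: eqP => x0.
  have -> : (p.-1 < n)%N = false by lia.
  rewrite x0 n0 ltn_eqF //; ring.
have -> : ((x : nat).-1 < n)%N = (x < n)%N || (x == n :> nat) by lia.
case: ltngtP => _ /=; ring.
Qed.

Lemma sum_step_fun : \sum_x step_fun x = 0.
Proof.
rewrite sum_Zp /step_fun sumrB -mulr_sumr.
rewrite sumr_const_nat subn0 (_ : \sum_(0 <= l < p) _ = n%:R).
  by rewrite -[_ *+ p]mulr_natl subrr.
have np := ltn_Zp n; rewrite (big_cat_nat (n := n)) //=; last exact: ltnW.
rewrite (eq_big_nat _ _ (F2 := fun=> 1)) => [|l /andP[_ ln]]; last first.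
  by rewrite val_ZpN ?ln // (ltn_trans ln).
rewrite [X in _ + X](eq_big_nat _ _ (F2 := fun=> 0)) => [|l /andP[nl lp]]; last first.
  by rewrite val_ZpN // ltnNge nl.
by rewrite !sumr_const_nat subn0 mul0rn addr0.
Qed.

(** Antidifference of step_fun in the coordinate x / q, in which the shift by q
    becomes the shift by one. *)
Definition solution x : R := antidiff (fun z => step_fun (z * q)) (x / q).

Lemma solution_diff x : solution x - solution (x - q) = step_fun x.
Proof.
rewrite /solution mulrBl divrr // antidiffP ?divrK //.
by rewrite -[RHS]sum_step_fun [RHS](reindex_inj (mulIr q_unit)).
Qed.

Lemma solution0 : solution 0 = 0.
Proof. by rewrite /solution mul0r /antidiff big_geq. Qed.

Lemma minor_solution :
  minor 0 0 (shift_diff_mul 1 q) (outside [:: n; 0]) (outside [:: n; 0]) = solution n.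
Proof.
rewrite (minor_shift_diff_mul_solve (f := solution)) ?unitr1 ?solution0 ?subr0 //.
by move=> a; rewrite !solution_diff step_fun_diff.
Qed.

(** Since 1 - S^-1 = - S^-1 (1 - S), the shifted and negated solution of the
    system of minor_solution solves this one, and the minor is
    X(-1) - X(n - 1).  Adding X n - X 0, the sum is Z n - Z 0 for Z = (1 - S) X.
    As (1 - S^q) Z = p (delta_n - delta_0), going from 0 to n in steps of q, Z
    stays constant up to the last step, where it jumps by p. *)
Lemma minor_solution_opp :
  minor 0 0 (shift_diff_mul (- 1) q) (outside [:: n; 0]) (outside [:: n; 0])
  = p%:R - solution n.
Proof.
(* The image of the previous solution under - S. *)
pose f x := - solution (x - 1).
have fE x : f x - f (x - q) = - step_fun (x - 1).
  by rewrite /f addrAC -solution_diff opprK opprD opprK addrC.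
rewrite (minor_shift_diff_mul_solve (f := f)) ?unitrN1 // => [|a]; last first.
  by rewrite !fE !opprK addrK -step_fun_diff addrC.
rewrite /f sub0r opprK.
pose Z x := solution x - solution (x - 1).
have ZE x : Z x - Z (x - q) = p%:R * ((x == n)%:R - (x == 0)%:R).
  rewrite -step_fun_diff -!solution_diff /Z (addrAC x (- q)); ring.
pose k := (n / q : 'Z_p).
have kn : (k : nat)%:R * q = n by rewrite natr_Zp /k divrK.
have k0 : (0 < k)%N.
  by rewrite lt0n; apply: contra n_neq0 => /eqP k0; rewrite -kn k0 mul0r.
(* The right-hand side of ZE vanishes at the multiples l q with 0 < l < k. *)
have Zk l : (l < k)%N -> Z (l%:R * q) = Z 0.
  elim: l => [|l IH] lk; first by rewrite mul0r.
  have lp : (l.+1 < p)%N := ltn_trans lk (ltn_Zp _).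
  rewrite -IH; last exact: ltnW.
  apply/eqP; rewrite -subr_eq0.
  rewrite (_ : l%:R * q = l.+1%:R * q - q); last first.
    by rewrite -natr1 mulrDl mul1r addrK.
  have neq m : (m < p)%N -> (l.+1 == m) = false ->
      (l.+1%:R * q == m%:R * q :> 'Z_p) = false.
    by move=> mp lm; rewrite (inj_eq (mulIr q_unit)) eq_ZpN.
  rewrite ZE -{1}kn neq ?ltn_Zp ?ltn_eqF //.
  by have := neq 0%N p_gt0 erefl; rewrite mul0r => ->; rewrite subrr mulr0.
have := ZE n; rewrite eqxx (negPf n_neq0) subr0 mulr1.
rewrite -{2}kn -(prednK k0) -natr1 mulrDl mul1r addrK Zk ?prednK //.
rewrite /Z solution0 !sub0r => <-; ring.
Qed.
End Solution.

End Circulant.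

(** * Signed incidences and half-revolutions *)

Section Incidence.
Variable R : realType.

Definition sign_of (T : tetra) : R := if positive T then 1 else -1.

Definition has_edge (T : tetra) (a : edge) : bool := lab T a.1 == a.2.

(** The quantity that governs all derivatives of deficit angles: a pair of edges
    of given kinds contributes the same geometric factor in every tetrahedron,
    up to the sign of the orientation. *)
Definition incidence (X : triang) (a b : edge) : R :=
  \sum_(T <- tetras X) sign_of T * (has_edge T a && has_edge T b)%:R.

Lemma incidenceC X a b : incidence X a b = incidence X b a.
Proof. by apply: eq_bigr => T _; rewrite andbC. Qed.

Lemma sign_ofN T l : sign_of (Tetra (~~ positive T) l) = - sign_of T.
Proof. by rewrite /sign_of /=; case: (positive T); rewrite ?opprK. Qed.

(** For pairs of edges that lie in a common face the three new tetrahedra and the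
    removed one cancel.  For opposite edges of the kinds xy, zw the change is
    minus the orientation times (old - new) tensor (old - new). *)
Lemma incidence_half_rev xy X a b :
  let d c := (lab (moving X) c.1 == c.2)%:R - (nedge X c.1 == c.2)%:R in
  incidence (half_rev xy X) a b = incidence X a b
    - sign_of (moving X) * (d a * d b)
      *+ ((a.1 \in [:: xy; opposite xy]) && (b.1 == opposite a.1)).
Proof.
rewrite /incidence !big_cons sign_ofN /= /has_edge /=.
rewrite /sign_of /= -/(sign_of (moving X)) /relab.
set e := sign_of (moving X); set S := \sum_(T <- _) _.
have bn (c d : bool) : (c && d)%:R = c%:R * d%:R :> R by rewrite -natrM mulnb.
rewrite !bn !inE.
have oxy : (opposite xy == xy) = false by case: (xy).
have xyo : (xy == opposite xy) = false by case: (xy).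
have oo : opposite (opposite xy) = xy by case: (xy).
case: (eqVneq a.1 xy) => [ea|na]; [|case: (eqVneq a.1 (opposite xy)) => [ea|na']];
  (case: (eqVneq b.1 xy) => [eb|nb]; [|case: (eqVneq b.1 (opposite xy)) => [eb|nb']]);
  rewrite ?ea ?eb ?oo ?eqxx ?oxy ?xyo ?(negPf nb) ?(negPf nb') /= ?mulr1n ?mulr0n; ring.
Qed.

(** The fixed distinguished tetrahedron has the label n - 1 on its edges AB, AC,
    BD and CD. *)
Definition non_still (n N : nat) := [seq i <- iota 0 N | i != n.-1].
(** The last label is that of the distinguished tetrahedron on which the
    half-revolutions act, since these always attach the most recent edges
    to it. *)
Definition inner_labels (n N : nat) := [seq i <- iota 0 N | (i != n.-1) && (i != N.-1)].

(** The two distinguished tetrahedra have different labels because n < p; with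
    them, the upper tetrahedra BC are enumerated by all labels below p. *)
Lemma perm_inner_labels (p n : nat) : (0 < n < p)%N ->
  perm_eq [:: n.-1, p.-1 & inner_labels n p] (iota 0 p).
Proof.
move=> hn; apply: uniq_perm; rewrite /= ?iota_uniq ?filter_uniq ?iota_uniq //.
  rewrite inE !mem_filter !eqxx !andbF orbF andbT /=.
  by apply/eqP; lia.
move=> x; rewrite !inE mem_filter mem_iota add0n /=.
by have [->|_] := eqVneq x n.-1; have [E|_] := eqVneq x p.-1; lia.
Qed.

Lemma incidence_lens (p q n : nat) a b : (0 < n < p)%N ->
  let h T : R := (has_edge T a && has_edge T b)%:R in
  incidence (lens p q n) a b = \sum_(0 <= l < p)
    (h (upper_CB p l) + h (lower_BC p q l) - h (upper_BC p l)
     - h (lower_CB p q l)).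
Proof.
move=> /andP[n0 np] h.
rewrite /incidence /tetras /lens /= !big_cons !big_cat !big_map /=.
have hp : perm_eq [:: n.-1, p.-1 & inner_labels n p] (index_iota 0 p).
  by rewrite /index_iota subn0 perm_inner_labels // n0.
rewrite !sumrB big_split /=.
rewrite -[X in _ + _ - X - _](perm_big _ hp) /= !big_cons.
have E (r : seq nat) (F : nat -> tetra) (s : bool) :
    (forall i, positive (F i) = s) ->
    \sum_(i <- r) sign_of (F i) * h (F i)
    = (if s then 1 else -1) * \sum_(i <- r) h (F i).
  by move=> Fs; rewrite mulr_sumr; apply: eq_bigr => i _; rewrite /sign_of Fs.
rewrite -!/(h _) (E _ (upper_BC p) false) // (E _ (lower_CB p q) false) //
  (E _ (upper_CB p) true) // (E _ (lower_BC p q) true) // /sign_of /= /index_iota subn0.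
ring.
Qed.

Lemma sum_shift_mod (p c : nat) (f : nat -> R) :
  \sum_(0 <= l < p) f ((l + c) %% p)%N = \sum_(0 <= l < p) f l.
Proof.
case: p => [|p]; first by rewrite !big_geq.
rewrite !big_mkord; pose g (i : 'I_p.+1) := i + inZp c.
have gE (i : 'I_p.+1) : ((i + c) %% p.+1)%N = g i by rewrite /= modnDmr.
by under eq_bigr => i _ do rewrite gE; rewrite [RHS](reindex_inj (addIr (inZp c))).
Qed.

(** Edges whose kinds are not opposite lie in a common face, and each face is
    shared by two tetrahedra of opposite orientations.  The faces BCD and ACD
    carry the same label in both tetrahedra; the faces ABD and ABC meet after
    a cyclic shift of the label by 1 and by q. *)
Lemma incidence_face (p q n : nat) (a b : edge) : (0 < n < p)%N ->
  b.1 != opposite a.1 -> incidence (lens p q n) a b = 0.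
Proof.
case: a b => [k i] [k' j] hn /= kk; rewrite incidence_lens // /has_edge /=.
pose s1 T : R := ((lab T k == i) && (lab T k' == j))%:R.
rewrite -[LHS]/(\sum_(0 <= l < p) (s1 (upper_CB p l) + s1 (lower_BC p q l)
  - s1 (upper_BC p l) - s1 (lower_CB p q l))).
have [|] := boolP ((k \in [:: eBC; eBD; eCD]) && (k' \in [:: eBC; eBD; eCD])).
  move=> /andP[K K']; rewrite big1 // => l _.
  by rewrite /s1 {s1}; case: k K {kk} => // _; case: k' K' => // _ /=; ring.
have [|] := boolP ((k \in [:: eAC; eAD; eCD]) && (k' \in [:: eAC; eAD; eCD])).
  move=> /andP[K K'] _; rewrite big1 // => l _.
  by rewrite /s1 {s1}; case: k K {kk} => // _; case: k' K' => // _ /=; ring.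
have [|] := boolP ((k \in [:: eAB; eAD; eBD]) && (k' \in [:: eAB; eAD; eBD])).
  move=> /andP[K K'] _ _.
  rewrite !sumrB big_split /= -(sum_shift_mod p 1 (fun l => s1 (upper_BC p l))).
  rewrite -(sum_shift_mod p 1 (fun l => s1 (lower_BC p q l))).
  rewrite -big_split -!sumrB big1 // => l _.
  by rewrite /s1 {s1}; case: k K {kk} => // _; case: k' K' => // _ /=;
    rewrite ?modnDml ?addn1 ?addSn; ring.
have [|] := boolP ((k \in [:: eAB; eAC; eBC]) && (k' \in [:: eAB; eAC; eBC])).
  move=> /andP[K K'] _ _ _.
  rewrite !sumrB big_split /= -(sum_shift_mod p q (fun l => s1 (upper_BC p l))).
  rewrite -(sum_shift_mod p q (fun l => s1 (upper_CB p l))).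
  rewrite -big_split -!sumrB big1 // => l _.
  by rewrite /s1 {s1}; case: k K {kk} => // _; case: k' K' => // _ /=;
    rewrite -?[(_ %% _).+1]addn1 ?modnDml ?addn1; ring.
by move: kk; rewrite /s1 {s1}; case: k; case: k'.
Qed.

Lemma incidence_ADBC (p q n : nat) : (0 < n < p)%N ->
  incidence (lens p q n) (eAD, 1)%N (eBC, 1)%N = - p%:R.
Proof.
move=> hn; rewrite incidence_lens // (eq_bigr (fun=> -1)) => [|l _]; last first.
  by rewrite /has_edge /=; ring.
by rewrite sumr_const_nat subn0 mulNrn.
Qed.

(** The block of G_3 with rows of kind k and columns of the opposite kind. *)
Definition block (X : triang) (k : ekind) (i j : nat) : R :=
  - incidence X (k, i) (opposite k, j).

Lemma block_lens_support (p q n i j : nat) (k : ekind) : (0 < n < p)%N ->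
  k \in [:: eAB; eAC] -> (p <= i)%N || (p <= j)%N ->
  block (lens p q n) k i j = 0.
Proof.
move=> hn K ij; rewrite /block incidence_lens // big_nat big1 ?oppr0 //= => l lp.
have lt (x : nat) : (x %% p < p)%N by apply: ltn_pmod; lia.
have ne x : (p <= x)%N -> (l == x) = false by lia.
have neq y x : (p <= x)%N -> ((y %% p)%N == x) = false by have := lt y; lia.
rewrite /has_edge /=.
by case: k K => // _ /=; case/orP: ij => ij; rewrite ?(ne _ ij) ?(neq _ _ ij) /=;
  rewrite ?andbF /=; ring.
Qed.

Definition det_non_still (n : nat) (X : triang) (k : ekind) : R :=
  minor 0%N 0%N (block X k) (non_still n (nedge X k)) (non_still n (nedge X k)).
Definition det_inner (n : nat) (X : triang) (k : ekind) : R :=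
  minor 0%N 0%N (block X k) (inner_labels n (nedge X k)) (inner_labels n (nedge X k)).

Section Lens.
Variables p q n : nat.
Hypotheses (hn : (0 < n < p)%N) (p_gt1 : (1 < p)%N).

Lemma shift_diff_mulE (u v a b : 'Z_p) :
  shift_diff_mul R u v a b = (a == b)%:R - (a == b + v)%:R
    - ((a == b + u)%:R - (a == b + u + v)%:R).
Proof.
by rewrite /shift_diff_mul shift_diff_act /shift_diff !subr_eq (addrAC b v).
Qed.

Lemma eq_modZp (x i : nat) : (i < p)%N ->
  ((x %% p)%N == i) = (x%:R == i%:R :> 'Z_p).
Proof. by move=> ip; rewrite -val_eqE /= !val_Zp_nat // (modn_small ip). Qed.

Lemma eq_Zp (x i : nat) : (x < p)%N -> (i < p)%N ->
  (x == i) = (x%:R == i%:R :> 'Z_p).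
Proof. by move=> xp ip; rewrite eq_ZpN. Qed.

Lemma sum_delta (b : 'Z_p) (f : 'Z_p -> R) :
  \sum_x f x * (x == b)%:R = f b.
Proof.
rewrite (bigD1 b) //= eqxx mulr1 big1 ?addr0 // => x /negPf ->.
by rewrite mulr0.
Qed.

(** The labels are shifted by one, so that the two removed ones, n - 1 and
    p - 1, become the residues n and 0. *)
Lemma block_lens_AB i j : (i < p)%N -> (j < p)%N ->
  block (lens p q n) eAB i j = shift_diff_mul R 1 q%:R i.+1%:R (j.+1%:R : 'Z_p).
Proof.
move=> ip jp; rewrite shift_diff_mulE -natr1 -[j.+1%:R]natr1.
rewrite /block incidence_lens // /has_edge /=.
rewrite (eq_big_nat _ _ (F2 := fun l => (fun x : 'Z_p =>
  ((x + 1 == i%:R)%:R + (x + q%:R == i%:R)%:R - (x == i%:R)%:R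
   - (x + q%:R + 1 == i%:R)%:R) * (x == j%:R)%:R) l%:R)); last first.
  move=> l /andP[_ lp]; rewrite !eq_modZp // !(eq_Zp lp) //.
  rewrite -!natr1 natrD.
  by do !case: eqP => _ /=; ring.
rewrite -(sum_Zp p_gt1 (fun x : 'Z_p =>
  ((x + 1 == i%:R)%:R + (x + q%:R == i%:R)%:R - (x == i%:R)%:R
   - (x + q%:R + 1 == i%:R)%:R) * (x == j%:R)%:R)) // sum_delta !(eq_sym _ i%:R).
rewrite (addrAC j%:R 1 q%:R) (addrAC _ 1 q%:R) (addrAC j%:R 1 q%:R).
by rewrite !(inj_eq (addIr 1)); ring.
Qed.

Lemma block_lens_AC i j : (i < p)%N -> (j < p)%N ->
  block (lens p q n) eAC i j = shift_diff_mul R (- 1) q%:R i.+1%:R (j.+1%:R : 'Z_p).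
Proof.
move=> ip jp; rewrite shift_diff_mulE -natr1 -[j.+1%:R]natr1.
rewrite /block incidence_lens // /has_edge /=.
have add1_eq (x y : 'Z_p) : (x + 1 == y) = (x == y - 1).
  by rewrite -(inj_eq (addIr 1) x) subrK.
rewrite (eq_big_nat _ _ (F2 := fun l => (fun x : 'Z_p =>
  ((x == i%:R)%:R - (x + q%:R == i%:R)%:R) * (x == j%:R - 1)%:R
  + ((x + q%:R == i%:R)%:R - (x == i%:R)%:R) * (x == j%:R)%:R) l%:R)); last first.
  move=> l /andP[_ lp]; rewrite !eq_modZp // !(eq_Zp lp) //.
  rewrite -!natr1 natrD add1_eq.
  by do !case: eqP => _ /=; ring.
rewrite -(sum_Zp p_gt1 (fun x : 'Z_p =>
  ((x == i%:R)%:R - (x + q%:R == i%:R)%:R) * (x == j%:R - 1)%:R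
  + ((x + q%:R == i%:R)%:R - (x == i%:R)%:R) * (x == j%:R)%:R)) //.
rewrite big_split /= !sum_delta !(eq_sym _ i%:R).
rewrite addrK (addrAC j%:R 1 q%:R).
by rewrite !(inj_eq (addIr 1)) !add1_eq (addrAC j%:R q%:R); ring.
Qed.

Lemma perm_labels_lens (cs : seq nat) : {in cs, forall c, c < p}%N ->
  perm_eq [seq (i.+1%:R : 'Z_p) | i <- iota 0 p & i \notin cs]
          (outside [seq (c.+1%:R : 'Z_p) | c <- cs]).
Proof.
move=> csp; have f_inj i j : (i < p)%N -> (j < p)%N ->
    (i.+1%:R == j.+1%:R :> 'Z_p) = (i == j).
  by move=> ip jp; rewrite -natr1 -[j.+1%:R]natr1 (inj_eq (addIr 1)) eq_ZpN.
apply: uniq_perm; rewrite ?outside_uniq //.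
  rewrite map_inj_in_uniq ?filter_uniq ?iota_uniq // => i j.
  rewrite !mem_filter !mem_iota => /andP[_ /andP[_ ip]] /andP[_ /andP[_ jp]] /eqP.
  by rewrite f_inj // => /eqP.
move=> x; rewrite mem_outside; apply/mapP/idP.
  case=> i; rewrite mem_filter mem_iota add0n => /andP[ics /andP[_ ip]] ->.
  apply: contra ics => /mapP[c ccs] /eqP.
  by rewrite (f_inj _ _ ip (csp _ ccs)) => /eqP ->.
move=> xcs; pose y : 'Z_p := x - 1.
have xE : x = (y : nat).+1%:R by rewrite -natr1 natr_Zp subrK.
exists (y : nat) => //; rewrite mem_filter mem_iota add0n ltn_Zp // andbT.
rewrite andbT; by apply: contra xcs => H; rewrite xE; apply: map_f.
Qed.

Let pN1 : (p.-1.+1%:R : 'Z_p) = 0.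
Proof. by rewrite prednK ?pchar_Zp // ltnW. Qed.
Let nN1 : (n.-1.+1%:R : 'Z_p) = n%:R.
Proof. by rewrite prednK //; case/andP: hn. Qed.

Hypothesis hpq : coprime p q.

Let q_unit : (q%:R : 'Z_p) \is a GRing.unit.
Proof. by rewrite unitZpE. Qed.

Let n_neq0 : (n%:R : 'Z_p) != 0.
Proof. by rewrite -[0]/(0%:R) eq_ZpN //; case/andP: hn => *; lia. Qed.

Lemma lens_minor (k : ekind) (u : 'Z_p) (cs : seq nat) :
  (forall i j, (i < p)%N -> (j < p)%N -> block (lens p q n) k i j
     = shift_diff_mul R u q%:R i.+1%:R (j.+1%:R : 'Z_p)) ->
  {in cs, forall c, c < p}%N ->
  let s := [seq i <- iota 0 p | i \notin cs] in
  let s' := outside [seq (c.+1%:R : 'Z_p) | c <- cs] in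
  minor 0%N 0%N (block (lens p q n) k) s s
  = minor 0 0 (shift_diff_mul R u q%:R) s' s'.
Proof.
move=> bE csp s s'.
rewrite -(minor_perm 0 _ (perm_labels_lens csp)) (minor_map 0 0 0%N 0%N) //.
apply: eq_minor => // i j.
by rewrite !mem_filter !mem_iota => /andP[_ /andP[_ ip]] /andP[_ /andP[_ jp]]; apply: bE.
Qed.

Lemma minor_non_still_lens k u : (forall i j, (i < p)%N -> (j < p)%N ->
    block (lens p q n) k i j = shift_diff_mul R u q%:R i.+1%:R (j.+1%:R : 'Z_p)) ->
  u \is a GRing.unit ->
  minor 0%N 0%N (block (lens p q n) k) (non_still n p) (non_still n p) = p%:R.
Proof.
move=> bE uu; rewrite -(minor_shift_diff_mul R p_gt1 n%:R uu q_unit) -nN1.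
rewrite -[outside _]/(outside [seq (c.+1%:R : 'Z_p) | c <- [:: n.-1]]) -(lens_minor bE) //.
  by congr minor; apply: eq_filter => i; rewrite inE.
by move=> c; rewrite inE => /eqP ->; lia.
Qed.

Lemma minor_inner_labels_lens k u : (forall i j, (i < p)%N -> (j < p)%N ->
    block (lens p q n) k i j = shift_diff_mul R u q%:R i.+1%:R (j.+1%:R : 'Z_p)) ->
  minor 0%N 0%N (block (lens p q n) k) (inner_labels n p) (inner_labels n p)
  = minor 0 0 (shift_diff_mul R u q%:R) (outside [:: n%:R : 'Z_p; 0])
      (outside [:: n%:R : 'Z_p; 0]).
Proof.
have -> : [:: n%:R : 'Z_p; 0] = [seq (c.+1%:R : 'Z_p) | c <- [:: n.-1; p.-1]].
  by rewrite /= nN1 pN1.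
move=> bE; rewrite -(lens_minor bE) //.
  by congr minor; apply: eq_filter => i; rewrite !inE negb_or.
by move=> c; rewrite !inE => /orP[] /eqP ->; lia.
Qed.

Definition lens_s : R := solution R n%:R (q%:R : 'Z_p) n%:R.

Lemma det_non_still_lens k : k \in [:: eAB; eAC] -> det_non_still n (lens p q n) k = p%:R.
Proof.
rewrite /det_non_still !inE => /orP[] /eqP -> /=.
  by apply: (minor_non_still_lens block_lens_AB); rewrite unitr1.
by apply: (minor_non_still_lens block_lens_AC); rewrite unitrN1.
Qed.

Lemma det_inner_lens_AB : det_inner n (lens p q n) eAB = lens_s.
Proof. by rewrite /det_inner /= (minor_inner_labels_lens block_lens_AB) minor_solution. Qed.

Lemma det_inner_lens_AC : det_inner n (lens p q n) eAC = p%:R - lens_s.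
Proof. by rewrite /det_inner /= (minor_inner_labels_lens block_lens_AC) minor_solution_opp. Qed.

End Lens.

Section ChainState.
Variables p n : nat.
Hypothesis hn : (0 < n < p)%N.

(** What a sequence of half-revolutions preserves.  The field on the number of
    the other tetrahedra matches the powers of the volume in the invariant, and
    the one on their orientations gives its sign. *)
Record chain_state (X : triang) : Prop := ChainState {
  cs_num : forall k, k \in [:: eAB; eAC] ->
    (p <= nedge X k)%N /\ nedge X (opposite k) = nedge X k;
  cs_still : forall k, k \in [:: eAB; eAC] ->
    lab (still X) k = n.-1 /\ lab (still X) (opposite k) = n.-1;
  cs_moving : forall k, k \in [:: eAB; eAC] ->
    lab (moving X) k = (nedge X k).-1
    /\ lab (moving X) (opposite k) = (nedge X k).-1;
  cs_ADBC : forall k, k \in [:: eAD; eBC] ->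
    [/\ nedge X k = 2, lab (still X) k = 0 & lab (moving X) k = 0]%N;
  cs_support : forall k i j, k \in [:: eAB; eAC] ->
    (nedge X k <= i)%N || (nedge X k <= j)%N -> block X k i j = 0;
  cs_face : forall a b, b.1 != opposite a.1 -> incidence X a b = 0;
  cs_ADBC_inc : incidence X (eAD, 1)%N (eBC, 1)%N = - p%:R;
  cs_size : (size (others X)).+2 = (2 * (nedge X eAB + nedge X eAC))%N;
  cs_sign : \prod_(T <- others X) sign_of T = 1
}.

Lemma lens_chain_state q : chain_state (lens p q n).
Proof.
split.
- by move=> k; rewrite !inE => /orP[] /eqP ->.
- by move=> k; rewrite !inE => /orP[] /eqP ->.
- by move=> k; rewrite !inE => /orP[] /eqP ->.
- by move=> k; rewrite !inE => /orP[] /eqP ->.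
- move=> k i j K ij; apply: block_lens_support => //.
  by move: K ij; rewrite !inE => /orP[] /eqP ->.
- by move=> a b; apply: incidence_face.
- exact: incidence_ADBC.
- rewrite /= !size_cat !size_map !size_iota.
  by have := perm_size (perm_inner_labels hn); rewrite size_iota /= => H;
    rewrite -!addSn H; lia.
rewrite /= !big_cat !big_map /=.
rewrite (eq_bigr (fun=> -1)) // [X in _ * (X * _)]big1 //.
rewrite [X in _ * (_ * (X * _))]big1 // [X in _ * (_ * (_ * X))](eq_bigr (fun=> -1)) //.
rewrite !mul1r !big_const_seq !count_predT !iter_mulr_1 size_iota -exprD.
have := congr1 odd (perm_size (perm_inner_labels hn)); rewrite size_iota /= negbK => E.
by rewrite -signr_odd oddD E addbb.
Qed.

Lemma incidence_half_rev_other X k a b :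
  ~~ ((a.1 \in [:: k; opposite k]) && (b.1 == opposite a.1)) ->
  incidence (half_rev k X) a b = incidence X a b.
Proof. by move=> /negPf H; rewrite incidence_half_rev H mulr0n subr0. Qed.

Lemma block_half_rev X k i j : chain_state X -> k \in [:: eAB; eAC] ->
  block (half_rev k X) k i j = block X k i j + sign_of (moving X)
    * ((i == (nedge X k).-1)%:R - (i == nedge X k)%:R)
    * ((j == (nedge X k).-1)%:R - (j == nedge X k)%:R).
Proof.
move=> cs K; rewrite /block incidence_half_rev /= inE !eqxx mulr1n.
have [_ ->] := cs_num cs K; have [-> ->] := cs_moving cs K.
rewrite !(eq_sym i) !(eq_sym j); ring.
Qed.

Lemma half_rev_chain_state X k : chain_state X -> k \in [:: eAB; eAC] ->
  chain_state (half_rev k X).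
Proof.
move=> cs K; split.
- move=> k' K'; have [pN E] := cs_num cs K'; rewrite /= E.
  split; first by rewrite (leq_trans pN) // leq_addr.
  by congr (_ + _)%N; case: (k) (k') K K' => // [] [].
- by move=> k' K'; have := cs_still cs K'.
- move=> k' K'; have [pN E] := cs_num cs K'; have [L1 L2] := cs_moving cs K'.
  rewrite /= /relab E L1 L2.
  have -> : (opposite k' \in [:: k; opposite k]) = (k' \in [:: k; opposite k]).
    by case: (k) (k') K K' => // [] [].
  by case: ifP => _; rewrite ?addn0 ?addn1.
- move=> k' K'; have [E1 E2 E3] := cs_ADBC cs K'; rewrite /= /relab E1 E2 E3.
  have -> : (k' \in [:: k; opposite k]) = false.
    by case: (k) (k') K K' => // [] [].
  by rewrite addn0.
- move=> k' i j K' ij.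
  have ij' : (nedge X k' <= i)%N || (nedge X k' <= j)%N.
    by move: ij; rewrite /=; lia.
  have [E|kk'] := eqVneq k' k.
    subst k'; rewrite block_half_rev // (cs_support cs) // add0r.
    have [pN _] := cs_num cs K; move: ij; rewrite /= inE eqxx addn1.
    have ne x : (nedge X k < x)%N ->
        (x == (nedge X k).-1)%:R - (x == nedge X k)%:R = 0 :> R.
      move=> xN; rewrite !gtn_eqF ?subrr //.
      by rewrite (leq_ltn_trans (leq_pred _)).
    by case/orP=> /ne ->; rewrite ?mulr0 ?mul0r.
  rewrite /block incidence_half_rev_other -?/(block X k' i j) ?(cs_support cs) //.
  by move: kk'; case: (k) (k') K K' => // [] [].
- move=> a b ab; rewrite incidence_half_rev (negPf ab) andbF mulr0n subr0.
  exact: (cs_face cs).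
- rewrite incidence_half_rev_other ?(cs_ADBC_inc cs) //.
  by case: (k) K.
- rewrite /= (cs_size cs).
  by case: (k) K => // _ /=; lia.
rewrite /= !big_cons (cs_sign cs) /sign_of /= mulr1.
by case: (positive _); rewrite ?mulrNN mulr1.
Qed.

(** With e = 1 or -1 the orientation of the tetrahedron operated on.  The new
    inner labels are the old ones together with the former last label, whose
    diagonal entry has been increased by e; this gives the second equation.
    Keeping also the new label, minor_chain gives the first. *)
Lemma minor_half_rev X k : chain_state X -> k \in [:: eAB; eAC] ->
  let e := sign_of (moving X) in
  det_non_still n (half_rev k X) k = e * det_non_still n X k /\
  det_inner n (half_rev k X) k = det_non_still n X k + e * det_inner n X k.
Proof.
move=> cs K e.
have [pN _] := cs_num cs K; have {}pN : (n.-1 < (nedge X k).-1)%N by lia.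
have N1 : nedge (half_rev k X) k = (nedge X k).+1 by rewrite /= inE eqxx addn1.
pose s := inner_labels n (nedge X k); set N := nedge X k in s pN N1 *.
have perm1 : perm_eq (non_still n N) (N.-1 :: s).
  apply: uniq_perm; rewrite /= ?filter_uniq ?iota_uniq //.
    by rewrite mem_filter eqxx andbF.
  by move=> x; rewrite inE !mem_filter mem_iota add0n; have [->|_] := eqVneq x N.-1; lia.
have perm2 : perm_eq (non_still n N.+1) (N :: N.-1 :: s).
  have -> : non_still n N.+1 = rcons (non_still n N) N.
    rewrite /non_still -addn1 iotaD filter_cat /= add0n.
    by rewrite (_ : N != n.-1) ?cats1 //; apply/eqP; lia.
  by rewrite perm_rcons perm_cons.
have inner_labelsS : inner_labels n N.+1 = non_still n N.
  rewrite /inner_labels /non_still -addn1 iotaD filter_cat /= addn1 /= eqxx andbF cats0.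
  by apply: eq_in_filter => i; rewrite mem_iota => iN; lia.
have Ns : N \notin s by rewrite mem_filter mem_iota add0n ltnn !andbF.
have N1s : N.-1 \notin s by rewrite mem_filter eqxx andbF.
split.
  rewrite /det_non_still N1 (minor_perm _ _ perm2) (minor_perm _ _ perm1).
  rewrite -(@minor_chain _ _ _ (block X k) N.-1 N s e) //.
  - by apply: eq_minor => // i j _ _; apply: block_half_rev.
  - by apply/eqP; lia.
  - by move=> i; apply: (cs_support cs) => //; rewrite leqnn orbT.
  - by move=> i; apply: (cs_support cs) => //; rewrite leqnn.
rewrite /det_inner /det_non_still N1 inner_labelsS !(minor_perm _ _ perm1).
rewrite -minor_corner //; apply: eq_minor => // i j si sj.
rewrite block_half_rev // -/N.
have neN x : x \in N.-1 :: s -> (x == N) = false.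
  rewrite -(perm_mem perm1) mem_filter mem_iota add0n => H; lia.
by rewrite !neN // !subr0 -mulrA -natrM mulnb mulr_natr.
Qed.

Lemma minor_half_rev_other X k k' : chain_state X -> k \in [:: eAB; eAC] ->
  k' \in [:: eAB; eAC] -> k' != k ->
  det_non_still n (half_rev k X) k' = det_non_still n X k'
  /\ det_inner n (half_rev k X) k' = det_inner n X k'.
Proof.
move=> cs K K' kk'.
have N1 : nedge (half_rev k X) k' = nedge X k'.
  by rewrite /= (_ : _ \in _ = false) ?addn0 //; case: (k) (k') K K' kk' => // [] [].
rewrite /det_non_still /det_inner N1; split; apply: eq_minor => // i j _ _;
  rewrite /block incidence_half_rev_other //;
  by move: kk'; case: (k) (k') K K' => // [] [].
Qed.

End ChainState.
End Incidence.

(** * Derivatives of the dihedral angles *)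

Section Geometry.
Variable R : realType.

Lemma dotE (u v : 'rV[R]_3) :
  dot u v = u 0 0 * v 0 0 + u 0 1 * v 0 1 + u 0 2 * v 0 2.
Proof.
rewrite /dot !big_ord_recl big_ord0 addr0 addrA.
by congr (_ + _ + _); congr (u _ _ * v _ _); apply: val_inj.
Qed.

Lemma tripleE (u v w : 'rV[R]_3) :
  triple u v w = u 0 0 * (v 0 1 * w 0 2 - v 0 2 * w 0 1)
    - u 0 1 * (v 0 0 * w 0 2 - v 0 2 * w 0 0)
    + u 0 2 * (v 0 0 * w 0 1 - v 0 1 * w 0 0).
Proof.
rewrite /triple (expand_det_row _ 0) !big_ord_recl big_ord0 addr0 /cofactor.
rewrite !(expand_det_row _ (0 : 'I_2)) !big_ord_recl !big_ord0 !addr0 /cofactor.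
rewrite !det_mx11 !mxE /=.
pose c (x : 'rV[R]_3) (k : nat) := x 0 (inord k).
have cE (x : 'rV[R]_3) (i : 'I_3) : x 0 i = c x i by rewrite /c inord_val.
rewrite !cE /= /bump /=.
ring.
Qed.

Lemma dot_ge0 (u : 'rV[R]_3) : 0 <= dot u u.
Proof. by rewrite dotE -!expr2; nra. Qed.

Lemma gram (u z w : 'rV[R]_3) :
  triple u z w ^+ 2
  = dot u u * (dot z z * dot w w - dot z w ^+ 2)
    - dot u z * (dot u z * dot w w - dot z w * dot u w)
    + dot u w * (dot u z * dot z w - dot z z * dot u w).
Proof. rewrite !dotE tripleE; ring. Qed.

Lemma cauchy_schwarz (u z : 'rV[R]_3) : dot u z ^+ 2 <= dot u u * dot z z.
Proof.
rewrite -subr_ge0 (_ : _ - _ = (u 0 0 * z 0 1 - u 0 1 * z 0 0) ^+ 2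
  + (u 0 0 * z 0 2 - u 0 2 * z 0 0) ^+ 2 + (u 0 1 * z 0 2 - u 0 2 * z 0 1) ^+ 2).
  by rewrite !addr_ge0 ?sqr_ge0.
by rewrite !dotE; ring.
Qed.

(** If u had length zero, Cauchy--Schwarz would make it orthogonal to everything
    and the Gram determinant would vanish. *)
Lemma dot_gt0 (u z w : 'rV[R]_3) : triple u z w != 0 -> 0 < dot u u.
Proof.
move=> V0; rewrite lt_def dot_ge0 andbT; apply: contra V0 => /eqP uu0.
have dot0 v : dot u v = 0.
  apply/eqP; rewrite -sqrf_eq0 -normr_le0 ger0_norm ?sqr_ge0 //.
  by rewrite (le_trans (cauchy_schwarz _ _)) // uu0 mul0r.
by rewrite -sqrf_eq0 gram !dot0 !mul0r !subr0 addr0.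
Qed.

Lemma law_of_cosines (u z : 'rV[R]_3) :
  dot u z = (dot u u + dot z z - dot (z - u) (z - u)) / 2.
Proof.
rewrite !dotE !mxE; by field.
Qed.

(** A vanishing determinant gives a nonzero vector orthogonal to the three
    edges at A, hence a plane through the four points. *)
Lemma vol6_neq0 (P : vertex -> 'rV[R]_3) :
  ~ coplanar P -> vol6 P vA vB vC vD != 0.
Proof.
move=> nc; apply/negP => V0; apply: nc.
rewrite /vol6 /triple -det_tr in V0.
have [u u0 uM] := det0P V0.
exists u, (dot u (P vA)); split=> // Z.
have dotB (v w : 'rV[R]_3) : dot u (v - w) = dot u v - dot u w.
  by rewrite !dotE !mxE; ring.
have H (i : 'I_3) : dot u [:: P vB - P vA; P vD - P vA; P vC - P vA]`_i = 0.
  have := congr1 (fun M : 'rV[R]_3 => M 0 i) uM; rewrite !mxE => <-.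
  by apply: eq_bigr => j _; rewrite !mxE.
case: Z => //; apply/eqP; rewrite -subr_eq0 -dotB; apply/eqP.
- exact: (H 0).
- exact: (H 2).
- exact: (H 1).
Qed.

(** With phi the angle, the hypothesis on V says that
    |V| = sqrt uu * sqrt al * sqrt be * sin phi, the sixfold volume computed
    from the edge and the two altitudes over it; the derivative of arc cosine
    brings the factor 1 / sin phi. *)
Lemma acos_derivative (zz ww uz uw uu x0 V : R) :
  let zw := (zz + ww - x0 ^+ 2) / 2 in
  let al := zz - uz ^+ 2 / uu in let be := ww - uw ^+ 2 / uu in
  0 < uu -> 0 <= al -> 0 <= be -> V != 0 ->
  uu * (al * be - (zw - uz * uw / uu) ^+ 2) = V ^+ 2 ->
  is_derive x0 1 (fun x : R => acos (((zz + ww - x ^+ 2) / 2 - uz * uw / uu)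
        / (Num.sqrt al * Num.sqrt be)))
    (Num.sqrt uu * x0 / `|V|).
Proof.
move=> zw al be uu0 al0 be0 V0 volE.
set c := zw - uz * uw / uu in volE.
have V2 : 0 < V ^+ 2 by rewrite exprn_even_gt0.
have abc : 0 < al * be - c ^+ 2 by rewrite -(pmulr_rgt0 _ uu0) volE.
have ab0 : 0 < al * be by rewrite (lt_le_trans abc) // gerBl sqr_ge0.
have s0 : 0 < Num.sqrt al * Num.sqrt be by rewrite -sqrtrM // sqrtr_gt0.
set s := Num.sqrt al * Num.sqrt be in s0 *.
have s2 : s ^+ 2 = al * be by rewrite exprMn !sqr_sqrtr.
have sn0 : s != 0 by rewrite gt_eqF.
pose g (x : R) := ((zz + ww - x ^+ 2) / 2 - uz * uw / uu) / s.
have cs : (c / s) ^+ 2 < 1.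
  by rewrite expr_div_n s2 ltr_pdivrMr // mul1r -subr_gt0.
have c1 : -1 < c / s < 1 by rewrite -ltr_norml -(@expr_lt1 _ 2) // real_normK ?num_real.
have dg : is_derive x0 1 g (- x0 / s).
  have -> : g = cst (((zz + ww) / 2 - uz * uw / uu) / s)
                - (id * id) * cst (2 * s)^-1.
    apply/funext => x; rewrite /g !fctE /cst /=; field.
    by rewrite sn0 gt_eqF.
  apply: is_derive_eq; rewrite /= /cst !scaler0 !add0r.
  rewrite /GRing.scale /= mulr1; clearbody s; clear -sn0; by field; rewrite sn0.
rewrite -[X in is_derive _ _ X]/(acos \o g).
have D := @is_derive1_comp R acos g x0 _ _ (is_derive1_acos c1) dg.
apply: (is_derive_eq D).

rewrite expr_div_n.
(* This is the square of the sine of the angle. *)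
have -> : 1 - c ^+ 2 / s ^+ 2 = V ^+ 2 / (uu * s ^+ 2).
  rewrite -volE -s2; clearbody s c; clear -sn0 uu0; field.
  by rewrite sn0 gt_eqF.
rewrite sqrtrM ?sqr_ge0 // sqrtr_sqr sqrtrV; last first.
  by rewrite mulr_ge0 ?sqr_ge0 // ltW.
rewrite sqrtrM ?ltW // sqrtr_sqr (gtr0_norm s0).
have r0 : Num.sqrt uu != 0 by rewrite sqrtr_eq0 -ltNge.
have n0 : `|V| != 0 by rewrite normr_eq0.
clearbody s; clear -sn0 r0 n0; by field; rewrite n0 sn0 r0.
Qed.

Definition nrm (u : 'rV[R]_3) : R := Num.sqrt (dot u u).

Lemma nrm2 u : nrm u ^+ 2 = dot u u.
Proof. by rewrite sqr_sqrtr // dot_ge0. Qed.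

Lemma len_kind_of (P : vertex -> 'rV[R]_3) X Y i : X <> Y ->
  len P (kind_of X Y, i) = nrm (P Y - P X).
Proof.
have nrmC u v : nrm (u - v) = nrm (v - u).
  by rewrite /nrm; congr Num.sqrt; rewrite !dotE !mxE; ring.
by case: X; case: Y => // _; rewrite /len /= -/(nrm _) // nrmC.
Qed.

Lemma dihedral_angle_derivative (X Y Z W : 'rV[R]_3) (V : R) :
  V != 0 -> triple (Y - X) (Z - X) (W - X) ^+ 2 = V ^+ 2 ->
  let uu := nrm (Y - X) ^+ 2 in
  let zz := nrm (Z - X) ^+ 2 in
  let ww := nrm (W - X) ^+ 2 in
  let uz := (uu + zz - nrm (Z - Y) ^+ 2) / 2 in
  let uw := (uu + ww - nrm (W - Y) ^+ 2) / 2 in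
  is_derive (nrm (W - Z)) 1 (fun x : R =>
    acos (((zz + ww - x ^+ 2) / 2 - uz * uw / uu)
        / (Num.sqrt (zz - uz ^+ 2 / uu) * Num.sqrt (ww - uw ^+ 2 / uu))))
    (nrm (Y - X) * nrm (W - Z) / `|V|).
Proof.
move=> V0 volE uu zz ww uz uw.
have uzE : uz = dot (Y - X) (Z - X).
  by rewrite (law_of_cosines (Y - X)) /uz /uu /zz !nrm2 opprB addrA subrK.
have uwE : uw = dot (Y - X) (W - X).
  by rewrite (law_of_cosines (Y - X)) /uw /uu /ww !nrm2 opprB addrA subrK.
have zwE : (zz + ww - nrm (W - Z) ^+ 2) / 2 = dot (Z - X) (W - X).
  by rewrite (law_of_cosines (Z - X)) /zz /ww !nrm2 opprB addrA subrK.
have uu_gt0 : 0 < uu.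
  by rewrite /uu nrm2 (@dot_gt0 _ (Z - X) (W - X)) // -sqrf_eq0 volE sqrf_eq0.
have <- : Num.sqrt uu = nrm (Y - X).
  by rewrite /uu sqrtr_sqr ger0_norm // sqrtr_ge0.
apply: acos_derivative => //.
- rewrite subr_ge0 ler_pdivrMr // uzE mulrC /uu /zz !nrm2; exact: cauchy_schwarz.
- rewrite subr_ge0 ler_pdivrMr // uwE mulrC /uu /ww !nrm2; exact: cauchy_schwarz.
rewrite zwE uzE uwE -volE gram -[dot (Y - X) (Y - X)]nrm2 -/uu.
rewrite -[dot (Z - X) (Z - X)]nrm2 -/zz -[dot (W - X) (W - X)]nrm2 -/ww.
clear -uu_gt0; clearbody uu zz ww; by field; rewrite gt_eqF.
Qed.

Lemma vol6_sqr (P : vertex -> 'rV[R]_3) k :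
  let: (X, Y) := ends k in let: (Z, W) := ends (opposite k) in
  triple (P Y - P X) (P Z - P X) (P W - P X) ^+ 2 = vol6 P vA vB vC vD ^+ 2.
Proof. by case: k => /=; rewrite /vol6 !tripleE !mxE; ring. Qed.

(** The classical formula d phi_k / d l_k' = l_k l_k' / |6 V| for opposite edges
    k, k'.  No other derivative survives in the deficit angles: in adjacent edges
    the contributions of the tetrahedra cancel. *)
Lemma dihedral_derivative (P : vertex -> 'rV[R]_3) k (L : R -> ekind -> R) :
  vol6 P vA vB vC vD != 0 ->
  (forall x, L x (opposite k) = x) ->
  (forall x k', k' <> opposite k -> L x k' = len P (k', 0)%N) ->
  is_derive (len P (opposite k, 0)%N) 1 (fun x => dihedral (L x) k)
    (len P (k, 0)%N * len P (opposite k, 0)%N / `|vol6 P vA vB vC vD|).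
Proof.
move=> V0 Lo Ln; have V2 := vol6_sqr P k.
have D X Y Z W : ends k = (X, Y) -> ends (opposite k) = (Z, W) ->
    [/\ X <> Y, X <> Z, X <> W, Y <> Z & Y <> W] ->
    Z <> W -> k = kind_of X Y -> opposite k = kind_of Z W ->
    [/\ kind_of X Z <> opposite k, kind_of X W <> opposite k,
        kind_of Y Z <> opposite k, kind_of Y W <> opposite k & k <> opposite k] ->
  is_derive (len P (opposite k, 0)%N) 1 (fun x => dihedral (L x) k)
    (len P (k, 0)%N * len P (opposite k, 0)%N / `|vol6 P vA vB vC vD|).
  move=> e1 e2 [XY XZ XW YZ YW] ZW kE oE [n1 n2 n3 n4 n5].
  rewrite e1 e2 in V2.
  have := dihedral_angle_derivative V0 V2; rewrite /= -!(len_kind_of P 0) // -kE -oE.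
  congr is_derive; apply/funext => x; rewrite /dihedral e1 e2 /= -oE.
  by rewrite Lo !Ln.
by case: (k) D => D; apply: D => //=.
Qed.

Lemma tvol6E (P : vertex -> 'rV[R]_3) T :
  tvol6 P T = sign_of R T * vol6 P vA vB vC vD.
Proof.
rewrite /tvol6 /sign_of; case: (positive T); rewrite ?mul1r // mulN1r.
by rewrite /vol6 !tripleE !mxE; ring.
Qed.

(** As a function of the length of b, the deficit angle at a is a constant plus
    the signed number of tetrahedra containing both edges times one fixed
    angle.  When that number vanishes the function is constant, whether or not
    the angle is differentiable. *)
Lemma ddeficitE (P : vertex -> 'rV[R]_3) X a b :
  vol6 P vA vB vC vD != 0 ->
  (b.1 != opposite a.1 -> incidence R X a b = 0) ->
  ddeficit P X a b =
    if b.1 == opposite a.1 then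
      - incidence R X a b * (len P a * len P b) / vol6 P vA vB vC vD
    else 0.
Proof.
move=> V0 W0; set V := vol6 P vA vB vC vD in V0 *.
pose g x := dihedral (fun k => if k == b.1 then x else len P (k, 0)%N) a.1.
pose c := \sum_(T <- tetras X | has_edge T a && ~~ has_edge T b)
   Num.sg (tvol6 P T) * dihedral (fun k => len P (k, 0)%N) a.1.
have E x : deficit P X (upd (len P) b x) a
    = - (Num.sg V * incidence R X a b) * g x - c.
  rewrite /deficit (bigID (fun T => has_edge T b)) /= opprD mulNr; congr (- _ - _).
    rewrite -mulrA mulr_suml mulr_sumr [RHS](bigID (fun T => has_edge T a && has_edge T b)) /=.
    rewrite [X in _ = _ + X]big1 ?addr0 => [|T /negPf ->]; last by rewrite mulr0 mul0r mulr0.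
    apply: eq_bigr => T /andP[Ta Tb]; rewrite [has_edge T a]Ta Tb mulr1 tvol6E sgrM.
    have -> : Num.sg (sign_of R T) = sign_of R T.
      by rewrite /sign_of; case: (positive T); rewrite ?sgr1 ?sgrN1.
    rewrite [RHS]mulrA [X in X * _]mulrC; congr (_ * _).
    congr (dihedral _ _); apply/funext => k; rewrite /upd.
    have [->|kb] := eqVneq k b.1.
      by rewrite (eqP Tb) -surjective_pairing eqxx.
    by case: eqP => // e; rewrite -e eqxx in kb.
  apply: eq_bigr => T /andP[Ta Tb]; congr (_ * dihedral _ _).
  apply/funext => k; rewrite /upd; case: eqP => // e.
  by move: Tb; rewrite /has_edge -e eqxx.
rewrite /ddeficit (_ : (fun x => _)
  = fun x => - (Num.sg V * incidence R X a b) * g x - c); last first.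
  by apply/funext.
rewrite derive1E; case: eqP => [ba|/eqP /W0 ->]; last first.
  apply: derive_val.
  rewrite (_ : (fun x => _) = cst (- c)).
    exact: is_derive_cst.
  by apply/funext => x; rewrite mulr0 oppr0 mul0r add0r.
have Dg : is_derive (len P b) 1 g (len P a * len P b / `|V|).
  have lenE (d : edge) : len P d = len P (d.1, 0%N) by case: (d).
  rewrite (lenE a) (lenE b) ba; apply: dihedral_derivative => // [x|x k'].
    by rewrite ba eqxx.
  by rewrite ba => /eqP/negPf ->.
apply: derive_val.
rewrite (_ : (fun x => _) = (- (Num.sg V * incidence R X a b) *: g) + cst (- c)) //.
apply: is_derive_eq. rewrite subr0 /GRing.scale /=.
have sV0 : Num.sg V != 0 by rewrite sgr_eq0.
rewrite normrEsg; clearbody V; clear -V0 sV0; by field; rewrite V0 sV0.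
Qed.

Lemma len_neq0 (P : vertex -> 'rV[R]_3) a :
  vol6 P vA vB vC vD != 0 -> len P a != 0.
Proof.
case: a => k i V0; have := vol6_sqr P k; rewrite /len /=.
case: (ends k) => X Y; case: (ends (opposite k)) => Z W V2.
rewrite sqrtr_eq0 -ltNge (@dot_gt0 _ (P Z - P X) (P W - P X)) //.
by rewrite -sqrf_eq0 V2 sqrf_eq0.
Qed.

End Geometry.

(** * Lattice points counted with roots of unity *)

Section Roots.
Variable F : numFieldType.

Lemma geometric_sum_inv (x : F) m : x != 0 -> x != 1 ->
  (1 - x ^- m) / (1 - x) = - \sum_(1 <= j < m.+1) x ^- j.
Proof.
move=> x0 x1; have x1' : 1 - x != 0 by rewrite subr_eq0 eq_sym.
elim: m => [|m IH]; first by rewrite big_geq // oppr0 expr0 invr1 subrr mul0r.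
rewrite big_nat_recr //= opprD -IH exprS invfM.
set y := x ^- m; clearbody y; clear -x0 x1'; by field; rewrite x0 x1'.
Qed.

Variables (p : nat) (z : F).
Hypothesis z_prim : p.-primitive_root z.

Lemma sum_powers_root (w : F) : w ^+ p = 1 ->
  \sum_(0 <= k < p) w ^+ k = p%:R *+ (w == 1).
Proof.
move=> wp; case: eqP => [->|/eqP w1].
  rewrite (eq_bigr (fun=> 1)) => [|k _]; last by rewrite expr1n.
  by rewrite sumr_const_nat subn0 mulr1n.
have /esym/eqP := subrX1 w p.
by rewrite wp subrr mulf_eq0 subr_eq0 (negPf w1) big_mkord mulr0n => /eqP.
Qed.

(** Both quotients are geometric sums, and their product is the sum of
    z^(k (q l - j)) over 0 < j < n, 0 < l < m; the first summand is the case
    k = 0.  Summing over k by orthogonality counts the pairs with q l = j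
    modulo p, and for each l there is at most one such j. *)
Lemma root_sum_count (n q m : nat) : (0 < n < p)%N -> (0 < m < p)%N -> coprime p q ->
  p%:R^-1 * ((n%:R - 1) * (m%:R - 1) +
   \sum_(1 <= k < p)
     (1 - z ^ (k%:Z * (1 - n%:Z))) / (1 - z ^ k%:Z) *
     ((1 - z ^ (k%:Z * q%:Z * (m%:Z - 1)))
      / (1 - z ^ (- (k%:Z * q%:Z)))))
  = \sum_(1 <= l < m) ((q * l) %% p < n)%N%:R :> F.
Proof.
case: n => // n; case: m => // m /andP[_ np] /andP[_ mp] cpq.
have p0 : (0 < p)%N := prim_order_gt0 z_prim.
have pF : p%:R != 0 :> F by rewrite pnatr_eq0 -lt0n.
have z0 : z != 0.
  apply/eqP => z0; have /eqP := prim_expr_order z_prim.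
  by rewrite z0 expr0n gtn_eqF // eq_sym oner_eq0.
pose w j l := z ^+ (q * l) / z ^+ j.
have wp j l : w j l ^+ p = 1.
  by rewrite expr_div_n -!exprM !(mulnC _ p) !exprM (prim_expr_order z_prim) !expr1n divr1.
have term k : (1 <= k < p)%N ->
    (1 - z ^ (k%:Z * (1 - n.+1%:Z))) / (1 - z ^ k%:Z) *
     ((1 - z ^ (k%:Z * q%:Z * (m.+1%:Z - 1))) / (1 - z ^ (- (k%:Z * q%:Z))))
    = \sum_(1 <= j < n.+1) \sum_(1 <= l < m.+1) w j l ^+ k.
  move=> /andP[k0 kp].
  have -> : 1 - n.+1%:Z = - n%:Z by lia.
  have -> : m.+1%:Z - 1 = m%:Z by lia.
  have zk1 : z ^+ k != 1.
    by rewrite -(prim_order_dvd z_prim) gtnNdvd.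
  have zkq1 : z ^+ (k * q) != 1.
    by rewrite -(prim_order_dvd z_prim) Gauss_dvdl // gtnNdvd.
  rewrite mulrN -!PoszM -!exprnN -!exprnP !exprM geometric_sum_inv ?expf_neq0 //.
  rewrite -(exprM z k q).
  have := @geometric_sum_inv (z ^+ (k * q))^-1 m.
  rewrite invr_eq0 expf_neq0 // invr_eq1 zkq1 -exprVn invrK => -> //.
  rewrite mulrNN mulr_suml; apply: eq_bigr => j _.
  rewrite mulr_sumr; apply: eq_bigr => l _.
  have -> : (z ^+ (k * q))^-1 ^- l = (z ^+ (k * q)) ^+ l by rewrite -exprVn invrK.
  rewrite /w expr_div_n -!exprM mulrC.
  by rewrite (mulnC j) (mulnC k q) mulnAC.
rewrite (eq_big_nat _ _ term).
have -> : (n.+1%:R - 1) * (m.+1%:R - 1)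
    = \sum_(1 <= j < n.+1) \sum_(1 <= l < m.+1) w j l ^+ 0 :> F.
  under eq_bigr => j _.
    under eq_bigr => l _ do rewrite expr0.
    rewrite sumr_const_nat subn1 /=; over.
  by rewrite sumr_const_nat subn1 /= -!natr1 !addrK -natrM mulnC mulrnA.
rewrite -(big_ltn (F := fun k => \sum_(1 <= j < n.+1) \sum_(1 <= l < m.+1) w j l ^+ k)) //.
rewrite exchange_big /=; under eq_bigr => j _.
  rewrite exchange_big /=; under eq_bigr => l _ do rewrite sum_powers_root //.
  over.
rewrite exchange_big /= mulr_sumr; apply: eq_big_nat => l /andP[l0 lm].
have lp : (l < p)%N by apply: leq_trans lm _; rewrite ltnW.
have ql0 : (0 < (q * l) %% p)%N.
  by rewrite lt0n -/(dvdn p (q * l)) Gauss_dvdr // gtnNdvd.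
rewrite mulr_sumr; set r := ((q * l) %% p)%N in ql0 *.
have rE : (q * l)%N = r %[mod p] by rewrite modn_mod.
rewrite (eq_big_nat _ _ (F2 := fun j => (j == r)%:R)) => [|j /andP[j0 jn]]; last first.
  rewrite /w -(inj_eq (mulIf (expf_neq0 j z0))) divfK ?expf_neq0 // mul1r.
  rewrite (eq_prim_root_expr z_prim) rE modn_mod (modn_small (leq_trans jn (ltnW np))).
  by rewrite eq_sym -[_ *+ nat_of_bool _]mulr_natr mulKf.
have [rn|nr] := ltnP r n.+1.
  rewrite (bigD1_seq r) ?iota_uniq ?mem_index_iota ?ql0 //= eqxx big1 ?addr0 //.
  by move=> j /negPf ->.
rewrite big_nat big1 // => j /andP[_ jn]; rewrite ltn_eqF //.
exact: leq_trans jn nr.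
Qed.
End Roots.

Section Zeta.
Variable R : realType.

Lemma complex_expi (t : R) k :
  Complex (cos t) (sin t) ^+ k = Complex (cos (t *+ k)) (sin (t *+ k)).
Proof.
elim: k => [|k IH]; first by rewrite expr0 mulr0n cos0 sin0.
rewrite exprS IH mulrS cosD sinD /=.
by apply/eqP; rewrite eq_complex /= !eqxx /= addrC mulrC eqxx.
Qed.

(** cos (2 y) = 1 would force sin y = 0, but y = pi k / p lies strictly between
    0 and pi. *)
Lemma zeta_primitive p : (1 < p)%N -> p.-primitive_root (zeta R p).
Proof.
move=> p1; have p0 : (0 < p)%N by rewrite ltnW.
have pR : p%:R != 0 :> R by rewrite pnatr_eq0 -lt0n.
rewrite /primitive_root_of_unity p0; apply/forallP => i; apply/eqP.
rewrite unity_rootE /zeta complex_expi.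
have [->|ip] := eqVneq i.+1 p.
  have -> : 2 * pi / p%:R *+ p = pi *+ 2 :> R.
    by rewrite -mulr_natr divfK // mulr_natl.
  rewrite cos2pi; apply/eqP.
  by rewrite -[pi *+ 2]add0r sinD2pi sin0.
apply/negP => /eqP [c1 _].
(* Half of the argument of the power of zeta. *)
pose y : R := pi * (i.+1%:R / p%:R).
have yE : 2 * pi / p%:R *+ i.+1 = y *+ 2.
  by rewrite /y -mulr_natr -[RHS]mulr_natr; field.
have y_lt : 0 < sin y.
  apply: sin_gt0_pi; rewrite /y mulr_gt0 ?pi_gt0 ?divr_gt0 ?ltr0n //=.
  rewrite gtr_pMr ?pi_gt0 // ltr_pdivrMr ?ltr0n // mul1r ltr_nat ltn_neqAle ip.
  exact: ltn_ord.
move: c1; rewrite yE cos_mulr2n cos2sin2 => c1.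
have : sin y ^+ 2 = 0 by lra.
by move/eqP; rewrite sqrf_eq0 gt_eqF.
Qed.

(** Here lens_s is the sum of n - p [q l mod p < n] over 0 < l <= qs, and the
    term l = qs has q l = n. *)
Lemma lens_s_nu (p q n qs : nat) : coprime p q -> (0 < q < p)%N -> (0 < n < p)%N ->
  (0 < qs < p)%N -> q * qs = n %[mod p] ->
  (lens_s R p q n)%:C%C = n%:R * qs%:R - p%:R * nu_val R p q n qs.
Proof.
move=> cpq q_bd hn hqs qqs.
have p1 : (1 < p)%N by lia.
rewrite /nu_val root_sum_count ?zeta_primitive //.
have q_unit : (q%:R : 'Z_p) \is a GRing.unit by rewrite unitZpE.
have nE : (n%:R : 'Z_p) = qs%:R * q%:R.
  by apply: val_inj; rewrite -natrM mulnC /= !val_Zp_nat.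
rewrite /lens_s /solution {2}nE mulrK // /antidiff val_ZpN //; last by case/andP: hqs.
have step_nat l : step_fun R n%:R ((l%:R : 'Z_p) * q%:R)
    = n%:R - p%:R * ((q * l) %% p < n)%N%:R.
  have nv : (n%:R : 'Z_p) = n :> nat by apply: val_ZpN; case/andP: hn.
  by rewrite /step_fun nv -(natrM _ l q) (mulnC l) val_Zp_nat.
under eq_bigr => l _ do rewrite step_nat.
have [qs0 qsp] := andP hqs.
rewrite sumrB sumr_const_nat subn1 /= -mulr_sumr big_nat_recr //=.
rewrite qqs (modn_small (m := n)) ?ltnn ?addr0; last by case/andP: hn.
rewrite rmorphB rmorphMn rmorphM !rmorph_nat rmorph_sum /= mulr_natr.
by congr (_ - _ * _); apply: eq_bigr => l _; rewrite rmorph_nat.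
Qed.
End Zeta.

(** * The invariant through the block determinants *)

Section Assembly.
Variables (R : realType) (P : vertex -> 'rV[R]_3) (p n : nat).
Hypothesis V_neq0 : vol6 P vA vB vC vD != 0.
Hypothesis hn : (0 < n < p)%N.
Let V := vol6 P vA vB vC vD.

Lemma G3_block X k i j : chain_state R p n X ->
  G3 P X (k, i) (opposite k, j) = block R X k i j.
Proof.
move=> cs; rewrite /G3 /block.
rewrite (ddeficitE V_neq0 (cs_face cs (a := (k, i)) (b := (opposite k, j)))) eqxx.
have := len_neq0 (k, i) V_neq0; have := len_neq0 (opposite k, j) V_neq0.
move: (len P _) (len P _) V_neq0 => x y.
set v := vol6 _ _ _ _ _; clearbody v; set t := incidence _ _ _ _; clearbody t.
by clear => v0 x0 y0; field; rewrite v0 x0 y0.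
Qed.

Lemma block_detE X k : chain_state R p n X -> block_det P X n k = det_inner R n X k.
Proof.
move=> cs; rewrite /block_det /det_inner -/(inner_labels n (nedge X k)).
rewrite -[LHS]/(minor _ _ _ _ _) (minor_map _ _ 0%N 0%N) //.
by apply: eq_minor => // i j _ _; apply: G3_block.
Qed.

Definition kind_edges (X : triang) (k : ekind) : seq edge :=
  [seq (k, i) | i <- inner_labels n (nedge X k)].

Lemma innerE X : chain_state R p n X ->
  inner X = kind_edges X eAB ++ kind_edges X eAC ++ [:: (eAD, 1%N)]
    ++ [:: (eBC, 1%N)] ++ [seq (eBD, i) | i <- inner_labels n (nedge X eAC)]
    ++ [seq (eCD, i) | i <- inner_labels n (nedge X eAB)].
Proof.
move=> cs; rewrite /inner /= cats0 !filter_cat !filter_map.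
pose free (a : edge) :=
  (lab (still X) a.1 != a.2) && (lab (moving X) a.1 != a.2).
have kinner k : k \in [:: eAB; eAC] ->
    (seq.filter (preim (pair k) free)
      (iota 0 (nedge X k)) = inner_labels n (nedge X k)) /\
    (seq.filter (preim (pair (opposite k)) free)
      (iota 0 (nedge X (opposite k))) = inner_labels n (nedge X k)).
  move=> K; have [_ E] := cs_num cs K; have [S1 S2] := cs_still cs K.
  have [M1 M2] := cs_moving cs K; rewrite E.
  by split; apply: eq_filter => i; rewrite /free /= ?S1 ?S2 ?M1 ?M2 ![_ == i]eq_sym.
rewrite (proj1 (kinner eAB isT)) (proj2 (kinner eAB isT)).
rewrite (proj1 (kinner eAC isT)) (proj2 (kinner eAC isT)).
have [E1 E2 E3] := cs_ADBC cs (isT : eAD \in [:: eAD; eBC]).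
have [E1' E2' E3'] := cs_ADBC cs (isT : eBC \in [:: eAD; eBC]).
by rewrite E1 E1' /= E2 E3 E2' E3'.
Qed.

Definition opp_incidence (X : triang) (a b : edge) : R :=
  if b.1 == opposite a.1 then - incidence R X a b else 0.

Lemma minor_tr (T : eqType) (x0 y0 : T) (F : T -> T -> R) rs cs : size rs = size cs ->
  minor y0 x0 (fun i j => F j i) cs rs = minor x0 y0 F rs cs.
Proof.
move=> sz; rewrite /minor -det_tr; case: _ / sz.
by congr (\det _); apply/matrixP => i j; rewrite !mxE.
Qed.

Lemma minor_opposite X k s : chain_state R p n X ->
  let e := (eAB, 0%N) in
  minor e e (opp_incidence X) ([seq (k, i) | i <- s] ++ [seq (opposite k, i) | i <- s])
     ([seq (k, i) | i <- s] ++ [seq (opposite k, i) | i <- s])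
  = (-1) ^+ size s * minor 0%N 0%N (block R X k) s s ^+ 2.
Proof.
move=> cs e; rewrite minor_anticat ?size_map //; last 2 first.
- move=> a b /mapP[i _ ->] /mapP[j _ ->]; rewrite /opp_incidence /=.
  by case: (k).
- move=> a b /mapP[i _ ->] /mapP[j _ ->]; rewrite /opp_incidence /=.
  by case: (k).
rewrite -mulrA expr2 !(minor_map e e 0%N 0%N) //; congr (_ * (_ * _)).
  by apply: eq_minor => // i j _ _; rewrite /opp_incidence /= eqxx.
rewrite -minor_tr //; apply: eq_minor => // i j _ _; rewrite /opp_incidence /=.
by rewrite incidenceC; case: (k).
Qed.

Lemma size_inner_labels X k : chain_state R p n X -> k \in [:: eAB; eAC] ->
  (size (inner_labels n (nedge X k))).+2 = nedge X k.
Proof.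
move=> cs K; have [pN _] := cs_num cs K.
have nN : (0 < n < nedge X k)%N.
  by case/andP: hn => n0 np; rewrite n0 (leq_trans np pN).
by have := perm_size (perm_inner_labels nN); rewrite size_iota.
Qed.

(** Grouped by opposite kinds, the matrix is block diagonal, with one
    anti-diagonal block for each of the pairs AB-CD, AC-BD and AD-BC.  The last
    pair has a single inner edge of each kind and contributes p^2. *)
Lemma minor_inner X : chain_state R p n X ->
  let e := (eAB, 0%N) in
  minor e e (opp_incidence X) (inner X) (inner X)
  = (-1) ^+ (nedge X eAB + nedge X eAC + 1) *
    (det_inner R n X eAB ^+ 2 * det_inner R n X eAC ^+ 2 * p%:R ^+ 2).
Proof.
move=> cs e; rewrite innerE //.
set ab := kind_edges X eAB; set ac := kind_edges X eAC.
set bd := [seq (eBD, i) | i <- _]; set cd := [seq (eCD, i) | i <- _].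
have hp : perm_eq (ab ++ ac ++ [:: (eAD, 1%N)] ++ [:: (eBC, 1%N)] ++ bd ++ cd)
   ((ab ++ cd) ++ (ac ++ bd) ++ ([:: (eAD, 1%N)] ++ [:: (eBC, 1%N)])).
  rewrite -!catA perm_cat2l; apply/seq.permP => a; rewrite !count_cat; ring.
rewrite (minor_perm _ _ hp) minor_cat; last first.
  move=> a b; rewrite !mem_cat => /orP[] /mapP[i _ ->] /orP[/orP[] /mapP[j _ ->]|];
   rewrite ?inE //; by case/orP => /eqP ->.
rewrite [X in _ * X]minor_cat; last first.
  move=> a b; rewrite !mem_cat => /orP[] /mapP[i _ ->];
   rewrite ?inE //; by case/orP => /eqP ->.
have -> := @minor_opposite X eAB (inner_labels n (nedge X eAB)) cs.
have -> := @minor_opposite X eAC (inner_labels n (nedge X eAC)) cs.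
have -> := @minor_opposite X eAD [:: 1%N] cs.
have -> : minor 0%N 0%N (block R X eAD) [:: 1%N] [:: 1%N] = p%:R.
  by rewrite /minor det_mx11 mxE /block /= (cs_ADBC_inc cs) opprK.
rewrite /det_inner expr1.
have sgn k : k \in [:: eAB; eAC] ->
    (-1) ^+ size (inner_labels n (nedge X k)) = (-1) ^+ nedge X k :> R.
  by move=> K; rewrite -[in RHS](size_inner_labels cs K) !exprS !mulN1r opprK.
rewrite !sgn // !exprD expr1; ring.
Qed.

(** Hence the volume factors of the determinant, of the product over tetrahedra
    and of the explicit fourth power cancel. *)
Lemma size_inner X : chain_state R p n X -> size (others X) = (size (inner X)).+4.
Proof.
move=> cs; have := cs_size cs; rewrite innerE // !size_cat !size_map /=.
have := size_inner_labels cs (isT : eAB \in [:: eAB; eAC]).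
have := size_inner_labels cs (isT : eAC \in [:: eAB; eAC]).
move: (size (inner_labels _ (nedge X eAC))) (size (inner_labels _ (nedge X eAB)))
  (size (others X)).
by move=> b a c <- <-; lia.
Qed.

Lemma det_f3E X : chain_state R p n X ->
  det_f3 P X = (\prod_(a <- inner X) len P a ^+ 2) / V ^+ size (inner X)
   * minor (eAB, 0%N) (eAB, 0%N) (opp_incidence X) (inner X) (inner X).
Proof.
move=> cs; rewrite /det_f3 -[LHS]/(minor _ _ _ _ _).
rewrite (@eq_minor _ _ _ _ _ _ (fun a b => len P a * opp_incidence X a b * (len P b / V))) //.
  rewrite minor_scale big_split /= big_const_seq count_predT iter_mulr_1 exprVn.
  by rewrite prodrXl expr2; ring.
move=> a b _ _; rewrite (ddeficitE V_neq0 (cs_face cs (a := a) (b := b))) /opp_incidence.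
by case: ifP => _; rewrite -/V; ring.
Qed.

Lemma prefactorE X : chain_state R p n X ->
  prefactor P X = (\prod_(a <- inner X) len P a ^+ 2) / V ^+ size (inner X).
Proof.
move=> cs; rewrite /prefactor -/V.
under [in X in _ / X]eq_bigr => T _ do rewrite tvol6E -mulrN.
rewrite [X in _ / X * _]big_split /= (cs_sign cs) mul1r big_const_seq count_predT iter_mulr_1.
have -> : (- vol6 P vA vB vC vD) ^+ size (others X) = V ^+ size (others X).
  have := cs_size cs; move: (size _) => m mE.
  rewrite exprNn -signr_odd (_ : odd m = false) ?mul1r //.
  by have := congr1 odd mE; rewrite mul2n odd_double /= negbK.
rewrite size_inner // -addn4 exprD invfM -!mulrA mulVf ?mulr1 // expf_neq0 //.
Qed.

(** The lengths and volumes in det f_3 are exactly the prefactor, so that only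
    the determinant of the signed incidences remains. *)
Lemma invariant_state X : chain_state R p n X ->
  omap (fun tau : R => tau * prefactor P X) (ext_frac 1 (det_f3 P X))
  = ext_frac ((-1) ^+ (nedge X eAB + nedge X eAC + 1))
     (det_inner R n X eAB ^+ 2 * det_inner R n X eAC ^+ 2 * p%:R ^+ 2).
Proof.
move=> cs; rewrite /ext_frac det_f3E // prefactorE //.
set L := _ / _; have L0 : L != 0.
  rewrite mulf_neq0 ?invr_eq0 ?expf_neq0 //.
  rewrite prodf_seq_neq0; apply/allP => a _ /=.
  by rewrite expf_neq0 // len_neq0.
rewrite minor_inner //; set e := (-1) ^+ _; set D := _ * p%:R ^+ 2.
have e0 : e != 0 by rewrite signr_eq0.
have ee : e * e = 1 by rewrite -expr2 sqrr_sign.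
clearbody L e D; rewrite !mulf_eq0 (negPf L0) (negPf e0) /=.
case: eqP => // /eqP D0 /=; congr Some.
rewrite mul1r invfM mulrAC mulVf // mul1r invfM; congr (_ / _).
by apply: (mulfI e0); rewrite mulfV // ee.
Qed.

End Assembly.

(** * Dependence on the framing *)

Section Framings.
Variables (R : realType) (p q n : nat).
Hypotheses (hpq : coprime p q) (hn : (0 < n < p)%N).
Let p_gt1 : (1 < p)%N. Proof. by case/andP: hn => n0; apply: leq_ltn_trans. Qed.

(** The argument b selects the direction, b = true being the negative one. *)
Definition revolved (b : bool) (h : nat) : triang :=
  iteri h (fun i => half_rev (if odd i (+) b then eAC else eAB)) (lens p q n).

Lemma framed_revolved z : framed p q n z
  = match z with Posz h => revolved false h | Negz h => revolved true h.+1 end.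
Proof.
case: z => h; apply: eq_iteri => i X; first by rewrite addbF.
by rewrite addbT; case: odd.
Qed.

(** The value reached from d after c steps of d' = e^c p + e d, in which e^c p
    is the determinant without the fixed distinguished label. *)
Definition chain_det (c : nat) (e d : R) : R := e ^+ c * (d + e * c%:R * p%:R).

Lemma chain_det_step c e d : e * e = 1 ->
  e ^+ c * p%:R + e * chain_det c e d = chain_det c.+1 e d.
Proof.
move=> ee; rewrite /chain_det exprSr -natr1.
have -> : e ^+ c * p%:R = e ^+ c * (e * e) * p%:R by rewrite ee mulr1.
ring.
Qed.

(** The orientation of the moving tetrahedron alternates and so do the kinds, so
    that each kind always meets the same orientation: in the positive direction
    -1 for AB and 1 for AC, in the negative one the opposite. *)
Lemma revolved_invariants b h :
  let X := revolved b h in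
  let e : R := (-1) ^+ (~~ b) in
  let c := if b then h./2 else uphalf h in
  let c' := if b then uphalf h else h./2 in
  [/\ chain_state R p n X, sign_of R (moving X) = (-1) ^+ h.+1,
      nedge X eAB = (p + c)%N /\ nedge X eAC = (p + c')%N,
      det_non_still R n X eAB = e ^+ c * p%:R /\
      det_non_still R n X eAC = (- e) ^+ c' * p%:R &
      det_inner R n X eAB = chain_det c e (lens_s R p q n) /\
      det_inner R n X eAC = chain_det c' (- e) (p%:R - lens_s R p q n)].
Proof.
move=> X e; elim: h @X => [|h IH].
  rewrite /= expr1; split.
  - exact: lens_chain_state.
  - by [].
  - by case: (b); rewrite !addn0.
  - by rewrite !(det_non_still_lens R hn) //; case: (b); rewrite !expr0 !mul1r.
  by rewrite /chain_det det_inner_lens_AB // det_inner_lens_AC //; case: b e => e;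
    rewrite !expr0 !mul1r !mulr0 !mul0r !addr0.
move=> X c c'; move: IH; set Y := revolved b h => /=.
set k := if b then _ else _; set k' := if b then _ else _.
move=> [csY eY [NAB NAC] [mAB mAC] [dAB dAC]].
have XE : X = half_rev (if odd h (+) b then eAC else eAB) Y by [].
have ee : e * e = 1 by rewrite -expr2 sqrr_sign.
have eNN : (- e) * (- e) = 1 by rewrite mulrNN.
have cs : chain_state R p n X.
  by rewrite XE; apply: half_rev_chain_state => //; case: (_ (+) _).
have eX : sign_of R (moving X) = (-1) ^+ h.+2.
  by rewrite XE sign_ofN eY [in RHS]exprS mulN1r.
have eS : sign_of R (moving Y) = if odd h (+) b then - e else e.
  rewrite eY -signr_odd /e /=; case: (odd h) (b) => [] [];
    by rewrite /= ?expr0 ?expr1 ?opprK.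
case: (boolP (odd h (+) b)) XE eS => hb XE eS.
- have [-> ->] : c = k /\ c' = k'.+1.
    rewrite /c /c' /k /k' /= !uphalf_half /=; move: hb; case: (b); case: (odd h) => //=; lia.
  have [m1 m2] := minor_half_rev hn csY (isT : eAC \in [:: eAB; eAC]).
  have [m1' m2'] := minor_half_rev_other csY (isT : eAC \in [:: eAB; eAC])
    (isT : eAB \in [:: eAB; eAC]) isT.
  rewrite -XE eS in m1 m2 m1' m2'.
  split=> //.
  + by rewrite -/Y NAB NAC /= addn0 addn1 addnS.
  + by rewrite m1 m1' mAB mAC exprS mulrA.
  + by rewrite m2 m2' dAB mAC dAC chain_det_step.
have [-> ->] : c = k.+1 /\ c' = k'.
  rewrite /c /c' /k /k' /= !uphalf_half /=; move: hb; case: (b); case: (odd h) => //=; lia.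
have [m1 m2] := minor_half_rev hn csY (isT : eAB \in [:: eAB; eAC]).
have [m1' m2'] := minor_half_rev_other csY (isT : eAB \in [:: eAB; eAC])
  (isT : eAC \in [:: eAB; eAC]) isT.
rewrite -XE eS in m1 m2 m1' m2'.
split=> //.
+ by rewrite -/Y NAB NAC /= addn0 addn1 addnS.
+ by rewrite m1 m1' mAB mAC exprS mulrA.
+ by rewrite m2 m2' mAB dAB dAC chain_det_step.
Qed.
End Framings.

Lemma block_det_revolved (R : realType) (P : vertex -> 'rV[R]_3) p q n b h :
  vol6 P vA vB vC vD != 0 -> coprime p q -> (0 < n < p)%N ->
  block_det P (revolved p q n b h) n eAB
    = chain_det p (if b then h./2 else uphalf h) ((-1) ^+ (~~ b)) (lens_s R p q n) /\
  block_det P (revolved p q n b h) n eAC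
    = chain_det p (if b then uphalf h else h./2) (- (-1) ^+ (~~ b)) (p%:R - lens_s R p q n).
Proof.
move=> V0 hpq hn; have [cs _ _ _ [<- <-]] := revolved_invariants R hpq hn b h.
by rewrite !(block_detE V0 _ cs).
Qed.

Lemma chain_det_sqr (R : realType) (p c : nat) (e d : R) : e * e = 1 ->
  chain_det p c e d ^+ 2 = (d + e * c%:R * p%:R) ^+ 2.
Proof. by move=> ee; rewrite /chain_det exprMn -exprM mulnC exprM expr2 ee expr1n mul1r. Qed.

Lemma invariant_revolved (R : realType) (P : vertex -> 'rV[R]_3) p q n b h :
  vol6 P vA vB vC vD != 0 -> coprime p q -> (0 < n < p)%N ->
  let X := revolved p q n b h in
  let e : R := (-1) ^+ (~~ b) in
  omap (fun tau : R => tau * prefactor P X) (ext_frac 1 (det_f3 P X))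
  = ext_frac ((-1) ^+ h.+1)
      ((lens_s R p q n + e * (if b then h./2 else uphalf h)%:R * p%:R) ^+ 2
       * (p%:R - lens_s R p q n - e * (if b then uphalf h else h./2)%:R * p%:R) ^+ 2
       * p%:R ^+ 2).
Proof.
move=> V0 hpq hn X e; have ee : e * e = 1 by rewrite -expr2 sqrr_sign.
have [cs _ [NAB NAC] _ [dAB dAC]] := revolved_invariants R hpq hn b h.
rewrite (invariant_state V0 hn cs) dAB dAC NAB NAC -/e !chain_det_sqr ?mulrNN //.
rewrite !mulNr; congr (ext_frac _ _).
rewrite -[LHS]signr_odd -[RHS]signr_odd; congr (_ ^+ _); congr nat_of_bool.
by rewrite uphalf_half; case: (b); lia.
Qed.

Theorem theorem10 (R : realType) (P : vertex -> 'rV[R]_3) (p q n : nat)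
    (hP : ~ coplanar P) (hpq : coprime p q)
    (hq : (0 < q < p)%N) (hn : (0 < n < p)%N) :
  let s := s_det P p q n 0 in
  let t := t_det P p q n 0 in
  let s_even (m : int) : R := (-1) ^ m * (s - m%:~R * p%:R) in
  let s_odd (m : int) : R := (-1) ^ (m + 1) * (s - m%:~R * p%:R - p%:R) in
  let t_even (m : int) : R := t + m%:~R * p%:R in
  [/\ forall m : int,
        framed_invariant P p q n (2 * m)
          = ext_frac (-1) (s_even m ^+ 2 * t_even m ^+ 2 * p%:R ^+ 2)
        /\ framed_invariant P p q n (2 * m + 1)
          = ext_frac 1 (s_odd m ^+ 2 * t_even m ^+ 2 * p%:R ^+ 2),
      forall m : nat,
        [/\ s_det P p q n (2 * m) = s_even m,
            s_det P p q n (2 * m).+1 = s_odd m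
          & t_det P p q n (2 * m) = t_even m],
      forall m : int, t_even m = p%:R - s + m%:~R * p%:R
    & forall qs : nat, (0 < qs < p)%N -> q * qs = n %[mod p] ->
        s%:C%C = n%:R * qs%:R - p%:R * nu_val R p q n qs].
Proof.
have V0 := vol6_neq0 hP.
have sE h : s_det P p q n h = chain_det p (uphalf h) (-1) (lens_s R p q n).
  by rewrite /s_det framed_revolved (proj1 (block_det_revolved _ _ V0 hpq hn)) expr1.
have tE h : t_det P p q n h = chain_det p h./2 1 (p%:R - lens_s R p q n).
  by rewrite /t_det framed_revolved (proj2 (block_det_revolved _ _ V0 hpq hn)) expr1 opprK.
rewrite (sE 0%N) (tE 0%N) /chain_det /= !expr0 !mul1r !mulr0 !mul0r !addr0.
set s := lens_s R p q n.
split=> [m|m|m|qs hqs qqs].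
- have sgn2 (k : int) : ((-1) ^ k : R) ^+ 2 = 1.
    case: k => k; first by rewrite -exprnP sqrr_sign.
    by rewrite NegzE -exprnN exprVn sqrr_sign invr1.
  have sgn_even k : (-1) ^+ k.*2.+2 = 1 :> R.
    by rewrite -signr_odd /= negbK odd_double.
  have sgn_odd k : (-1) ^+ k.*2.+1 = -1 :> R.
    by rewrite -signr_odd /= odd_double.
  rewrite !exprMn !sgn2 !mul1r /framed_invariant !framed_revolved.
  case: m => k.
    have -> : 2 * Posz k = Posz (2 * k) by lia.
    rewrite -[Posz (2 * k) + 1]/(Posz (2 * k + 1)) addn1.
    rewrite !invariant_revolved //= mul2n uphalf_double doubleK.
    rewrite -/s !sgn_odd !sgn_even expr1 -!pmulrn -natr1.
    by split; congr ext_frac; ring.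
  have -> : 2 * Negz k + 1 = Negz (2 * k) by lia.
  have -> : 2 * Negz k = Negz (2 * k).+1 by lia.
  rewrite !invariant_revolved //= mul2n uphalf_double doubleK.
  rewrite -/s -doubleS !sgn_odd !doubleS !sgn_even expr0 NegzE mulrNz -!pmulrn -natr1.
  by split; congr ext_frac; ring.
- rewrite !sE tE mul2n uphalf_double doubleK uphalfE /= doubleK.
  rewrite /chain_det -/s -!exprnP -!pmulrn; split.
  + ring.
  + rewrite addn1 -natr1; ring.
  by rewrite expr1n !mul1r.
- by [].
exact: lens_s_nu.
Qed.
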